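(* Let $m,n\ge1$. The data $\mathbb{M}_\#$ described in the context is a module over $\mathbb{Y}_m^{op}\times\mathbb{Y}_n^{op}\times\mathbb{Y}_{m+n-1}$ (it satisfies all commuting relations), and the tensor product with it defines a functor from the category of $\mathbb{Y}_m\times\mathbb{Y}_n$-modules to the category of $\mathbb{Y}_{m+n-1}$-modules that is a categorification of the $\#$ product, i.e. that induces at the level of Grothendieck groups the product $\#:\mathrm{Dend}(m)\otimes\mathrm{Dend}(n)\to\mathrm{Dend}(m+n-1)$.
   Context: **Trees and Tamari order.** A planar binary tree is either a dot $\circ$ or a pair $(x\,y)$ of planar binary trees; its degree is its number of dots minus one; $\mathbb{Y}_n$ is the set of planar binary trees of degree $n\ge1$; $Y=(\circ\,\circ)$. The Tamari order on $\mathbb{Y}_n$: $x\le y$ if $x$ is obtained from $y$ by a sequence of local changes replacing a subtree $(a(bc))$ by $((ab)c)$, with $a,b,c$ planar binary trees, possibly dots. **Modules.** A $\mathbb{Y}_n$-module is a finite-dimensional representation over $\mathbb{Q}$ of the Hasse diagram of $\mathbb{Y}_n$, with edges oriented decreasingly, satisfying all commutativity relations (equivalently a module over the incidence algebra); similarly for products of such posets and for $op$ (reversed arrows). The Grothendieck group of $\mathbb{Y}_n$-modules is identified with $\mathrm{Dend}(n)=\mathbb{Z}\mathbb{Y}_n$ by sending the simple module at $T$ to $T$; that of $\mathbb{Y}_m\times\mathbb{Y}_n$-modules is identified with $\mathrm{Dend}(m)\otimes\mathrm{Dend}(n)$ by sending the simple at $(s,t)$ to $s\otimes t$. A functor $F$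 induces a linear map $f$ on Grothendieck groups if $[F(N)]=f([N])$ for every module $N$. **Dendriform operad.** The composition $\circ_i:\mathrm{Dend}(m)\otimes\mathrm{Dend}(n)\to\mathrm{Dend}(m+n-1)$, $1\le i\le m$, is that of the dendriform (nonsymmetric) operad: a dendriform algebra has two bilinear operations $\prec,\succ$ with $(a\prec b)\prec c=a\prec(b\prec c+b\succ c)$, $(a\succ b)\prec c=a\succ(b\prec c)$, $(a\prec b+a\succ b)\succ c=a\succ(b\succ c)$. Each tree $x\in\mathbb{Y}_m$ gives an $m$-ary operation: $Y(a)=a$, and for $x=(l\,r)$ with $l$ of degree $k-1$, $x(a_1,\dots,a_m)=l(a_1,\dots,a_{k-1})\succ a_k\prec r(a_{k+1},\dots,a_m)$, omitting factors for which $l$ or $r$ is a dot. Then $x\circ_i y$ is the unique element of $\mathrm{Dend}(m+n-1)$ whose associated operation is $x(a_1,\dots,a_{i-1},y(a_i,\dots,a_{i+n-1}),a_{i+n},\dots,a_{m+n-1})$. **The product $\#$.** $\theta$ is the linear automorphism of each $\mathrm{Dend}(n)$ determined by $\theta\big(\sum_{y\ge x}y\big)=-\sum_{y\le x}y$ for all $x\in\mathbb{Y}_n$. For $x\in\mathrm{Dend}(n)$ and $y\in\mathrm{Dend}(m)$, $x\# y=-\theta^{-1}(\theta(y)\circ_1\theta(x))=-\theta(\theta^{-1}(x)\circ_n\theta^{-1}(y))\in\mathrm{Dend}(m+n-1)$ (the two expressions are known to agree). **The tri-module.** $\mathscr{P}(x)=\sum_{y\le x}y$. $\mathbb{M}_\#$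 has $\mathbb{Q}$ at each $(x,y,z)\in\mathbb{Y}_m\times\mathbb{Y}_n\times\mathbb{Y}_{m+n-1}$ such that $z$ occurs in $\mathscr{P}(x)\#\mathscr{P}(y)$ and $0$ elsewhere; each arrow of the quiver $\mathbb{Y}_m^{op}\times\mathbb{Y}_n^{op}\times\mathbb{Y}_{m+n-1}$ (arrows change exactly one coordinate along an arrow of the corresponding factor) acts as the identity if its source and target both carry $\mathbb{Q}$, and as $0$ otherwise. The tensor product is taken over the incidence algebra of $\mathbb{Y}_m\times\mathbb{Y}_n$: $N\mapsto N\otimes_{\mathbb{Y}_m\times\mathbb{Y}_n}\mathbb{M}_\#$. *)

(* Defs.v *)
From HB Require Import structures.
From mathcomp Require Import all_boot all_order all_algebra.
From mathcomp Require Import zify boolp classical_sets.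

Set Implicit Arguments.
Unset Strict Implicit.
Unset Printing Implicit Defensive.

Import Order.TTheory GRing.Theory.
Local Open Scope ring_scope.

(** * Planar binary trees and the Tamari order *)

Inductive bintree : Type := Dot | Node of bintree & bintree.

Fixpoint bintree_encode (t : bintree) : GenTree.tree unit :=
  match t with
  | Dot => GenTree.Leaf tt
  | Node l r => GenTree.Node 0 [:: bintree_encode l; bintree_encode r]
  end.

Fixpoint bintree_decode (t : GenTree.tree unit) : option bintree :=
  match t with
  | GenTree.Leaf _ => Some Dot
  | GenTree.Node _ [:: l; r] =>
      match bintree_decode l, bintree_decode r with
      | Some l', Some r' => Some (Node l' r')
      | _, _ => None
      end
  | _ => None
  end.

Lemma bintree_encodeK : pcancel bintree_encode bintree_decode.
Proof. by elim=> //= l -> r ->. Qed.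

HB.instance Definition _ := Countable.copy bintree (pcan_type bintree_encodeK).

(* The number of inner nodes, which is the number of dots minus one. *)
Fixpoint degree (t : bintree) : nat :=
  if t is Node l r then (degree l + degree r).+1 else 0%N.

Record Y (n : nat) : Type := MkY { ytree :> bintree; _ : degree ytree == n }.

HB.instance Definition _ n := [isSub for @ytree n].
HB.instance Definition _ n := [Countable of Y n by <:].

Fixpoint trees_of_height_le (h : nat) : seq bintree :=
  if h is h'.+1 then
    Dot :: [seq Node l r | l <- trees_of_height_le h', r <- trees_of_height_le h']
  else [:: Dot].

Lemma mem_trees_of_height_le h t :
  (degree t <= h)%N -> t \in trees_of_height_le h.
Proof.
elim: h t => [|h IH] [|l r] //=; rewrite ?inE //= ltnS => le_h.
apply/allpairsP; exists (l, r); split=> //; apply: IH.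
  exact: leq_trans (leq_addr _ _) le_h.
exact: leq_trans (leq_addl _ _) le_h.
Qed.

Definition Y_enum n : seq (Y n) := pmap insub (undup (trees_of_height_le n)).

Lemma Y_enum_uniq n : uniq (Y_enum n).
Proof. by rewrite pmap_sub_uniq ?undup_uniq. Qed.

Lemma mem_Y_enum n (t : Y n) : t \in Y_enum n.
Proof.
rewrite mem_pmap_sub mem_undup mem_trees_of_height_le //.
by case: t => t /= /eqP ->.
Qed.

HB.instance Definition _ n :=
  isFinite.Build (Y n) (Finite.uniq_enumP (@Y_enum_uniq n) (@mem_Y_enum n)).

(* [rotation y x]: x is obtained from y by replacing one subtree (a(bc)) by
   ((ab)c). *)
Fixpoint rotation (y x : bintree) : bool :=
  match y, x with
  | Node l r, Node l' r' =>
      [|| (if r is Node b c then (l' == Node l b) && (r' == c) else false),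
          rotation l l' && (r == r')
        | (l == l') && rotation r r']
  | _, _ => false
  end.

Definition tamari_le n (x y : Y n) : bool :=
  connect (fun u v : Y n => rotation u v) y x.

(* Antisymmetry: rotations strictly increase the following statistic. *)
Fixpoint left_weight (t : bintree) : nat :=
  if t is Node l r then (degree l + left_weight l + left_weight r)%N else 0%N.

Lemma rotation_degree y x : rotation y x -> degree x = degree y.
Proof.
elim: y x => [|l IHl r IHr] [|l' r'] //= /or3P[| |].
- by case: r {IHr} => //= b c /andP[/eqP -> /eqP ->] /=; rewrite addSn addnS addnA.
- by move=> /andP[/IHl -> /eqP ->].
- by move=> /andP[/eqP -> /IHr ->].
Qed.

Lemma rotation_weight y x : rotation y x -> (left_weight y < left_weight x)%N.
Proof.
elim: y x => [|l IHl r IHr] [|l' r'] //= /or3P[| |].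
- case: r {IHr} => //= b c /andP[/eqP -> /eqP ->] /=.
  lia.
- move=> /andP[rl /eqP ->]; rewrite ltn_add2r (rotation_degree rl).
  by rewrite ltn_add2l IHl.
- by move=> /andP[/eqP -> rr]; rewrite ltn_add2l IHr.
Qed.

Lemma tamari_le_weight n (x y : Y n) :
  tamari_le x y -> (x == y) || (left_weight y < left_weight x)%N.
Proof.
case/connectP=> p; elim: p y => [|z p IH] y /=; first by move=> _ ->; rewrite eqxx.
case/andP=> /rotation_weight wyz pzp ex.
by case/orP: (IH _ pzp ex) => [/eqP ->|/(ltn_trans wyz) ->]; rewrite ?wyz orbT.
Qed.

Lemma tamari_le_refl n : reflexive (@tamari_le n).
Proof. by move=> x; apply: connect0. Qed.

Lemma tamari_le_anti n : antisymmetric (@tamari_le n).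
Proof.
move=> x y /andP[/tamari_le_weight /orP[/eqP //|wyx]].
case/tamari_le_weight/orP=> [/eqP //|wxy].
by have:= ltn_trans wyx wxy; rewrite ltnn.
Qed.

Lemma tamari_le_trans n : transitive (@tamari_le n).
Proof. by move=> y x z xy yz; apply: connect_trans yz xy. Qed.

Fact tamari_display : Order.disp_t. Proof. exact: Order.Disp tt tt. Qed.

HB.instance Definition _ n := Order.Le_isPOrder.Build tamari_display (Y n)
  (@tamari_le_refl n) (@tamari_le_anti n) (@tamari_le_trans n).

(** * Quivers and their representations over the rationals *)

Record quiver : Type := Quiver { vertex :> finType; arrow : rel vertex }.

(* Edges are oriented decreasingly: there is an arrow x -> y iff x covers y. *)
Definition hasse d (P : finPOrderType d) : quiver :=
  @Quiver P (fun x y => (y < x)%O && [forall z, ~~ ((y < z)%O && (z < x)%O)]).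

Definition opq (Q : quiver) : quiver := @Quiver Q (fun x y => arrow y x).

Definition prodq (Q R : quiver) : quiver :=
  @Quiver (Q * R)%type (fun u v =>
    (arrow u.1 v.1 && (u.2 == v.2)) || ((u.1 == v.1) && arrow u.2 v.2)).

Record qrep (Q : quiver) : Type := QRep {
  robj :> Q -> vectType rat;
  rmap : forall x y : Q, arrow x y -> 'Hom(robj x, robj y) }.

Inductive qpath (Q : quiver) : Q -> Q -> Type :=
  | PathNil x : qpath x x
  | PathCons x y z (a : arrow x y) (p : qpath y z) : qpath x z.

Fixpoint path_map (Q : quiver) (V : qrep Q) (x y : Q) (p : qpath x y) :
    'Hom(V x, V y) :=
  match p in qpath x y return 'Hom(V x, V y) with
  | PathNil x => \1%VF
  | PathCons x y z a p => (path_map V p \o rmap V a)%VF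
  end.

Definition commuting (Q : quiver) (V : qrep Q) : Prop :=
  forall (x y : Q) (p q : qpath x y), path_map V p = path_map V q.

Record qmodule (Q : quiver) : Type :=
  QModule { qrep_of :> qrep Q; qmodule_comm : commuting qrep_of }.

Record qhom (Q : quiver) (N N' : qmodule Q) : Type := QHom {
  hmap :> forall x : Q, 'Hom(N x, N' x);
  hmap_nat : forall (x y : Q) (a : arrow x y),
    (rmap N' a \o hmap x = hmap y \o rmap N a)%VF }.

Lemma qhom_id_nat (Q : quiver) (N : qmodule Q) (x y : Q) (a : arrow x y) :
  (rmap N a \o \1 = \1 \o rmap N a)%VF.
Proof. by rewrite comp_lfun1l comp_lfun1r. Qed.

Definition qhom_id (Q : quiver) (N : qmodule Q) : qhom N N :=
  @QHom Q N N (fun x => \1%VF) (@qhom_id_nat Q N).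

Lemma qhom_comp_nat (Q : quiver) (N N' N'' : qmodule Q)
    (g : qhom N' N'') (f : qhom N N') (x y : Q) (a : arrow x y) :
  (rmap N'' a \o (g x \o f x) = (g y \o f y) \o rmap N a)%VF.
Proof. by rewrite comp_lfunA hmap_nat -!comp_lfunA hmap_nat. Qed.

Definition qhom_comp (Q : quiver) (N N' N'' : qmodule Q)
    (g : qhom N' N'') (f : qhom N N') : qhom N N'' :=
  @QHom Q N N'' (fun x => g x \o f x)%VF (qhom_comp_nat g f).

Record qfunctor (Q R : quiver) : Type := QFunctor {
  fobj :> qmodule Q -> qmodule R;
  fmap : forall N N' : qmodule Q, qhom N N' -> qhom (fobj N) (fobj N');
  fmap_id : forall N : qmodule Q, fmap (qhom_id N) = qhom_id (fobj N);
  fmap_comp : forall (N N' N'' : qmodule Q) (g : qhom N' N'') (f : qhom N N'),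
    fmap (qhom_comp g f) = qhom_comp (fmap g) (fmap f) }.

(** * Tensor product of modules *)

Section Tensor.

Variables A B R : quiver.

Definition trimodule : Type := qmodule (prodq (prodq (opq A) (opq B)) R).

(* Right action of the arrows of A x B, and left action of those of R. *)
Lemma tri_arrow_op (c c' : prodq A B) (z : R) :
  arrow c c' ->
  @arrow (prodq (prodq (opq A) (opq B)) R) (c', z) (c, z).
Proof.
move=> /= cc'; rewrite eqxx andbT; apply/orP; left.
by rewrite (eq_sym c'.2) (eq_sym c'.1).
Qed.

Lemma tri_arrow (c : prodq A B) (z z' : R) :
  arrow z z' -> @arrow (prodq (prodq (opq A) (opq B)) R) (c, z) (c, z').
Proof. by move=> zz'; apply/orP; right; rewrite /= eqxx. Qed.

(* A bilinear map from the right module M(-, z) and the left module N, over the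
   incidence algebra of A x B, that is balanced: since this algebra is generated
   by its idempotents (one for each vertex) and by the arrows, such a map
   amounts to bilinear maps N(c) x M(c, z) -> U for all vertices c, compatible
   with the arrows. *)
Definition balanced (N : qmodule (prodq A B)) (M : trimodule) (z : R)
    (U : vectType rat)
    (b : forall c : prodq A B, 'Hom(N c, 'Hom(M (c, z), U))) : Prop :=
  forall (c c' : prodq A B) (a : arrow c c') (v : N c) (w : M (c', z)),
    b c' (rmap N a v) w = b c v (rmap M (tri_arrow_op z a) w).

Definition is_tensor (N : qmodule (prodq A B)) (M : trimodule) (z : R)
    (T : vectType rat)
    (t : forall c : prodq A B, 'Hom(N c, 'Hom(M (c, z), T))) : Prop :=
  balanced t /\
  forall (U : vectType rat)
         (b : forall c : prodq A B, 'Hom(N c, 'Hom(M (c, z), U))),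
    balanced b ->
    exists! h : 'Hom(T, U), forall c v w, h (t c v w) = b c v w.

(* F is the functor N |-> N (x) M: for each z, (F N)(z) is the tensor product of
   N and M(-, z), where r (v (x) w) = v (x) r w for every arrow r of R, and
   F(phi) = phi (x) 1. *)
Definition is_tensor_functor (M : trimodule) (F : qfunctor (prodq A B) R) :
    Prop :=
  exists t : forall (N : qmodule (prodq A B)) (z : R) (c : prodq A B),
      'Hom(N c, 'Hom(M (c, z), F N z)),
    [/\ forall N z, is_tensor (t N z),
        forall N z z' (r : arrow z z') c v w,
          rmap (F N) r (t N z c v w) = t N z' c v (rmap M (tri_arrow c r) w)
      & forall N N' (phi : qhom N N') z c v w,
          fmap F phi z (t N z c v w) = t N' z c (phi c v) w].

End Tensor.

(** * Grothendieck groups *)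

Definition short_exact (Q : quiver) (N' N N'' : qmodule Q)
    (f : qhom N' N) (g : qhom N N'') : Prop :=
  forall x : Q,
    [/\ lker (f x) = 0%VS, limg (f x) = lker (g x) & limg (g x) = fullv].

(* One-dimensional at T and zero elsewhere; as Hasse diagrams have no loops, all
   arrows then act by zero. *)
Definition is_simple_at (Q : quiver) (T : Q) (S : qmodule Q) : Prop :=
  forall x : Q, \dim {:S x} = (x == T).

Definition basis_elt (I : finType) (i : I) : {ffun I -> int} :=
  [ffun j => (j == i)%:R].

(* N |-> [N], with the Grothendieck group identified with the free abelian group
   on the vertices by sending the simple module at T to T. *)
Definition is_class_map (Q : quiver) (cl : qmodule Q -> {ffun Q -> int}) :
    Prop :=
  (forall (N' N N'' : qmodule Q) (f : qhom N' N) (g : qhom N N''),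
     short_exact f g -> cl N = cl N' + cl N'') /\
  (forall (T : Q) (S : qmodule Q), is_simple_at T S -> cl S = basis_elt T).

(* Such a map exists. *)
Lemma dim_is_class_map (Q : quiver) :
  is_class_map (fun N : qmodule Q => [ffun x : Q => (\dim {:N x})%:Z]).
Proof.
split=> [N' N N'' f g fg|T S simS]; apply/ffunP=> x; rewrite !ffunE; last first.
  by rewrite simS; case: eqP.
have [kf fg_x ig] := fg x.
rewrite -(limg_ker_dim (g x) fullv) capfv -fg_x ig -(limg_ker_dim (f x) fullv).
by rewrite capfv kf dimv0 add0n PoszD.
Qed.

Definition induces (Q R : quiver) (F : qfunctor Q R)
    (f : {ffun Q -> int} -> {ffun R -> int}) : Prop :=
  forall (clQ : qmodule Q -> {ffun Q -> int})
         (clR : qmodule R -> {ffun R -> int}),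
    is_class_map clQ -> is_class_map clR ->
    forall N : qmodule Q, clR (F N) = f (clQ N).

(** * The dendriform operad *)

Record dendAlgebra : Type := DendAlgebra {
  dcarrier :> zmodType;
  dprec : dcarrier -> dcarrier -> dcarrier;
  dsucc : dcarrier -> dcarrier -> dcarrier;
  dprecDl : left_distributive dprec +%R;
  dprecDr : right_distributive dprec +%R;
  dsuccDl : left_distributive dsucc +%R;
  dsuccDr : right_distributive dsucc +%R;
  dprec_prec : forall a b c,
    dprec (dprec a b) c = dprec a (dprec b c + dsucc b c);
  dsucc_prec : forall a b c, dprec (dsucc a b) c = dsucc a (dprec b c);
  dsucc_succ : forall a b c,
    dsucc (dprec a b + dsucc a b) c = dsucc a (dsucc b c) }.

(* The arguments are numbered from 0; only the first [degree x] are used.  The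
   value at the dot is irrelevant. *)
Fixpoint tree_op (D : dendAlgebra) (x : bintree) (a : nat -> D) : D :=
  match x with
  | Dot => 0
  | Node l r =>
      let k := degree l in
      let ar := fun j => a (k.+1 + j)%N in
      match l, r with
      | Dot, Dot => a k
      | Node _ _, Dot => dsucc (tree_op l a) (a k)
      | Dot, Node _ _ => dprec (a k) (tree_op r ar)
      | Node _ _, Node _ _ => dprec (dsucc (tree_op l a) (a k)) (tree_op r ar)
      end
  end.

Definition Dend (n : nat) : zmodType := {ffun Y n -> int}.

Definition dend_op (D : dendAlgebra) n (w : Dend n) (a : nat -> D) : D :=
  \sum_(t : Y n) tree_op t a *~ w t.

(* [u] is inserted at position i (numbered from 1), in place of n arguments. *)
Definition insert_args (D : Type) (i n : nat) (u : D) (a : nat -> D) (j : nat) : D :=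
  if (j.+1 < i)%N then a j else if j.+1 == i then u else a (j + n - 1)%N.

(* The unique element with the given associated operation. *)
Definition dend_comp m n (i : nat) (x : Dend m) (y : Dend n) :
    Dend (m + n).-1 :=
  xget 0 [set w : Dend (m + n).-1 | forall (D : dendAlgebra) (a : nat -> D),
    dend_op w a =
    dend_op x (insert_args i n (dend_op y (fun j => a (i.-1 + j)%N)) a)].

(** * The product # *)

Definition up_sum n (x : Y n) : Dend n :=
  \sum_(y : Y n | (x <= y)%O) basis_elt y.

Definition down_sum n (x : Y n) : Dend n :=
  \sum_(y : Y n | (y <= x)%O) basis_elt y.

(* The elements [up_sum x] form a basis, and so do the elements [down_sum x]. *)
Definition theta n (v : Dend n) : Dend n :=
  xget 0 [set w : Dend n | exists a : Y n -> int,
    v = \sum_x up_sum x *~ a x /\ w = - \sum_x down_sum x *~ a x].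

Definition theta_inv n (v : Dend n) : Dend n :=
  xget 0 [set w : Dend n | theta w = v].

Definition sharp m n (x : Dend m) (y : Dend n) : Dend (m + n).-1 :=
  - theta (dend_comp m (theta_inv x) (theta_inv y)).

(* The tensor product Dend(m) (x) Dend(n) is the free abelian group on
   Y_m x Y_n. *)
Definition sharp_lin m n (w : {ffun Y m * Y n -> int}) : Dend (m + n).-1 :=
  \sum_(p : Y m * Y n) sharp (basis_elt p.1) (basis_elt p.2) *~ w p.

(** * The tri-module *)

Definition occurs_sharp m n (x : Y m) (y : Y n) (z : Y (m + n).-1) : bool :=
  sharp (down_sum x) (down_sum y) z != 0.

Definition Mquiver m n : quiver :=
  prodq (prodq (opq (hasse (Y m))) (opq (hasse (Y n)))) (hasse (Y (m + n).-1)).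

Definition Msupport m n (u : Mquiver m n) : bool :=
  occurs_sharp u.1.1 u.1.2 u.2.

(* The space at u is Q^1 or Q^0.  The b x b' matrix [pid_mx 1] is the 1 x 1
   identity matrix when b = b' = 1, and is empty otherwise. *)
Definition Msharp m n : qrep (Mquiver m n) :=
  @QRep (Mquiver m n) (fun u => 'rV[rat]_(Msupport u))
    (fun u v _ => linfun (mulmxr (pid_mx 1 : 'M_(Msupport u, Msupport v)))).

(* Main.v *)
Require Import Defs.
From HB Require Import structures.
From mathcomp Require Import all_boot all_order all_algebra.
From mathcomp Require Import zify ring boolp classical_sets functions.

(** Write [Ytake z] and [Ydrop z] for the trees that the in-order labelled tree z
    of degree m + n - 1 induces on its first m and its last n inner nodes; both
    maps are monotone for the Tamari order.  The whole theorem reduces to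
      (v # w)(z) = v(Ytake z) * w(Ydrop z).
    To see this, let U_x be the operation of the upper sum of x.  It satisfies
    U_(l r)(a) = U_l * (a_k \prec U_r), where * is the sum of the two products, so
    that inserting U_y at the last input of U_x gives U_(x.y), where x.y grafts x
    on y along its right border.  As theta exchanges upper and lower sums up to
    sign, P(x) # P(y) = P(x.y), and z <= x.y iff Ytake z <= x and Ydrop z <= y.

    Consequently, for fixed z, the support of M is the filter generated by
    (Ytake z, Ydrop z): the right module M(-, z) is representable, and N (x) M is
    the pull-back of N along z |-> (Ytake z, Ydrop z).  The functor is therefore
    exact, and all class maps are given by dimensions. *)

Set Implicit Arguments.
Unset Strict Implicit.
Unset Printing Implicit Defensive.

(* [Defs] comes last because [Dot] is shadowed by the libraries. *)
Import Order.TTheory GRing.Theory VectorInternalTheory Defs.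

(** * The Tamari order, cutting and grafting *)

(** The Tamari order on trees of all degrees at once, so that subtrees, cuts and grafts are compared
    without carrying degree proofs; [tamari_leP] returns to [Y n]. *)
Inductive tle : bintree -> bintree -> Prop :=
  | tle_refl x : tle x x
  | tle_step x y z : rotation y x -> tle y z -> tle x z.

Lemma tle_trans x y z : tle x y -> tle y z -> tle x z.
Proof. by elim=> // {}x u v ru _ IH /IH; apply: tle_step. Qed.

Lemma rotation_tle x y : rotation y x -> tle x y.
Proof. by move=> ?; apply: tle_step (tle_refl _). Qed.

Lemma tle_homo (f : bintree -> bintree) x y :
  (forall x y, rotation y x -> tle (f x) (f y)) -> tle x y -> tle (f x) (f y).
Proof.
move=> fP; elim=> [?|{}x u v /fP ru _]; first exact: tle_refl.
exact: tle_trans ru.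
Qed.

Lemma tle_degree x y : tle x y -> degree x = degree y.
Proof. by elim=> // {}x u v /rotation_degree -> _. Qed.

Lemma rotation_case (P : bintree -> bintree -> Prop) :
  (forall a b c, P (Node (Node a b) c) (Node a (Node b c))) ->
  (forall l l' r, rotation l l' -> P l' l -> P (Node l' r) (Node l r)) ->
  (forall l r r', rotation r r' -> P r' r -> P (Node l r') (Node l r)) ->
  forall x y, rotation y x -> P x y.
Proof.
move=> P0 Pl Pr x y; elim: y x => [|l IHl r IHr] [|l' r'] //= /or3P[| |].
- by case: r {IHr} => // b c /andP[/eqP -> /eqP ->].
- by case/andP=> rl /eqP <-; apply: Pl => //; apply: IHl.
- by case/andP=> /eqP <- rr; apply: Pr => //; apply: IHr.
Qed.

Lemma tle_node l l' r r' : tle l l' -> tle r r' -> tle (Node l r) (Node l' r').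
Proof.
move=> ll rr; apply: (@tle_trans _ (Node l' r)).
  apply: (@tle_homo (fun u => Node u r)) ll => x y rxy; apply: rotation_tle.
  by rewrite /= rxy eqxx /= orbT.
apply: (@tle_homo (Node l')) rr => x y rxy; apply: rotation_tle => /=.
by rewrite rxy eqxx /= !orbT.
Qed.

Lemma tle_rot a b c : tle (Node (Node a b) c) (Node a (Node b c)).
Proof. by apply: rotation_tle; rewrite /= !eqxx. Qed.

(** Going up, ((ab)c) becomes (a(bc)). This cannot happen at a root whose left subtree is a dot, so
    every change takes place inside r. *)
Lemma tle_Dotl r z :
  tle (Node Dot r) z -> exists2 r', z = Node Dot r' & tle r r'.
Proof.
move ex: (Node Dot r) => x xz; elim: xz r ex => [? r <-|{}x y {}z ryx _ IH r ex].
  by exists r => //; apply: tle_refl.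
have [r1 [e1 rr]] : exists r1, y = Node Dot r1 /\ rotation r1 r.
  case: y ryx {IH} => //= l s; rewrite -ex; case: l => [|l1 l2].
    by move=> /=; case: s => //= b c; rewrite ?orbF => rr; exists (Node b c).
  by case: s => [|? ?]; rewrite /= ?andbF ?orbF.
by have [r2 -> le12] := IH _ (esym e1); exists r2 => //; apply: tle_step rr le12.
Qed.

Lemma degreeY n (t : Y n) : degree t = n.
Proof. by case: t => ? /= /eqP. Qed.

Lemma tamari_leP n (x y : Y n) : reflect (tle x y) (x <= y)%O.
Proof.
apply: (iffP idP) => [/connectP[p]|].
  elim: p y => [|u p IH] y /=; first by move=> _ ->; apply: tle_refl.
  case/andP=> ryu pu ex; apply: tle_trans (IH _ pu ex) _.
  exact: rotation_tle.
move ex: (ytree x) => tx; move ey: (ytree y) => ty xy.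
elim: xy x ex y ey => [t x ex y ey|t u v ru _ IH x ex y ey].
  suff -> : x = y by [].
  by apply: val_inj; rewrite /= ex ey.
have du : degree u == n.
  by rewrite -(rotation_degree ru) -ex; case: (x).
apply: connect_trans (IH (MkY du) erefl y ey) (connect1 _).
by rewrite /= ex.
Qed.

(** * Cutting a tree at an in-order position *)

Fixpoint tree_take (k : nat) (t : bintree) : bintree :=
  if t is Node l r then
    if (k <= degree l)%N then tree_take k l
    else Node l (tree_take (k - (degree l).+1) r)
  else Dot.

Fixpoint tree_drop (k : nat) (t : bintree) : bintree :=
  if t is Node l r then
    if (k <= degree l)%N then Node (tree_drop k l) r
    else tree_drop (k - (degree l).+1) r
  else Dot.

Lemma degree_tree_take k t : degree (tree_take k t) = minn k (degree t).
Proof.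
elim: t k => [|l IHl r IHr] k /=; first by rewrite minn0.
by case: ifP => kl; rewrite /= ?IHl ?IHr; lia.
Qed.

Lemma degree_tree_drop k t : degree (tree_drop k t) = (degree t - k)%N.
Proof.
elim: t k => [|l IHl r IHr] k //=.
by case: ifP => kl; rewrite /= ?IHl ?IHr; lia.
Qed.

Lemma degree0 t : degree t = 0%N -> t = Dot.
Proof. by case: t. Qed.

Lemma tree_take_all k t : (degree t <= k)%N -> tree_take k t = t.
Proof.
elim: t k => [|l IHl r IHr] k //= dk.
by case: ifP => lk; [lia | rewrite IHr //; lia].
Qed.

Lemma tree_take0 t : tree_take 0 t = Dot.
Proof. by apply: degree0; rewrite degree_tree_take min0n. Qed.

Lemma tree_drop_all k t : (degree t <= k)%N -> tree_drop k t = Dot.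
Proof. by move=> dk; apply: degree0; rewrite degree_tree_drop; lia. Qed.

Lemma tree_take_root l r : tree_take (degree l) (Node l r) = l.
Proof. by rewrite /= leqnn tree_take_all. Qed.

Lemma tree_drop_root l r : tree_drop (degree l) (Node l r) = Node Dot r.
Proof. by rewrite /= leqnn tree_drop_all. Qed.

(** The rotation of (a(bc)) into ((ab)c) concerns two nodes, one between a and b, the other between
    b and c. If the cut removes at least one of them, the two results agree; if it keeps both, they
    still differ by a rotation. The same holds for [tle_drop]. *)
Lemma tle_take k x y : tle x y -> tle (tree_take k x) (tree_take k y).
Proof.
apply: tle_homo => {}x {}y rxy; elim/rotation_case: x y / rxy k.
- move=> a b c k /=.
  have -> : (k - (degree a).+1 <= degree b)%N =
            (k <= (degree a + degree b).+1)%N.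
    by apply/idP/idP; lia.
  have [ka|ka] := leqP k (degree a).
    by rewrite (leqW (leq_trans ka (leq_addr _ _))); apply: tle_refl.
  case: ifP => _; first exact: tle_refl.
  rewrite (_ : k - _ - _ = k - (degree a + degree b).+2)%N; last lia.
  exact: tle_rot.
- move=> l l' r rl IH k /=; rewrite (rotation_degree rl); case: ifP => // _.
  exact: tle_node (rotation_tle rl) (tle_refl _).
- move=> l r r' rr IH k /=; case: ifP => _; first exact: tle_refl.
  exact: tle_node (tle_refl _) (IH _).
Qed.

Lemma tle_drop k x y : tle x y -> tle (tree_drop k x) (tree_drop k y).
Proof.
apply: tle_homo => {}x {}y rxy; elim/rotation_case: x y / rxy k.
- move=> a b c k /=.
  have -> : (k - (degree a).+1 <= degree b)%N =
            (k <= (degree a + degree b).+1)%N.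
    by apply/idP/idP; lia.
  have [ka|ka] := leqP k (degree a).
    by rewrite (leqW (leq_trans ka (leq_addr _ _))); apply: tle_rot.
  case: ifP => _; first exact: tle_refl.
  rewrite (_ : k - _ - _ = k - (degree a + degree b).+2)%N; last lia.
  exact: tle_refl.
- move=> l l' r rl IH k /=; rewrite (rotation_degree rl); case: ifP => _.
    exact: tle_node (IH _) (tle_refl _).
  exact: tle_refl.
- move=> l r r' rr IH k /=; case: ifP => _ //.
  exact: tle_node (tle_refl _) (rotation_tle rr).
Qed.

(** * Grafting a tree on the right border of another *)

Fixpoint graft (l y : bintree) : bintree :=
  if y is Node l' r' then Node (graft l l') r' else l.

(** The last in-order node of x is merged with the first one of y: y takes its place, and its left
    subtree moves to the leftmost dot of y. *)
Fixpoint tree_comp (x y : bintree) : bintree :=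
  match x with
  | Dot => y
  | Node l Dot => graft l y
  | Node l r => Node l (tree_comp r y)
  end.

Lemma degree_graft l y : degree (graft l y) = (degree l + degree y)%N.
Proof. by elim: y => [|l' IH r' _] /=; rewrite ?addn0 // IH; lia. Qed.

Lemma degree_tree_comp x y :
  (0 < degree x)%N -> degree (tree_comp x y) = (degree x + degree y).-1.
Proof.
elim: x => [|l _ [|b c] IH] //= _; first by rewrite degree_graft; lia.
by rewrite IH //=; lia.
Qed.

Lemma tree_take_graft l y :
  (0 < degree y)%N -> tree_take (degree l).+1 (graft l y) = Node l Dot.
Proof.
elim: y => [|l' IH r' _] //= _; rewrite degree_graft.
case: l' IH => [|a b] IH.
  by rewrite /= addn0 ltnn subSS subnn tree_take0.
by rewrite IH //= (_ : (_ < _)%N = true) //; lia.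
Qed.

Lemma tree_drop_graft l y : tree_drop (degree l) (graft l y) = y.
Proof.
elim: y => [|l' IH r' _] /=; first by rewrite tree_drop_all.
by rewrite degree_graft leq_addr IH.
Qed.

Lemma tree_take_comp x y : (0 < degree x)%N -> (0 < degree y)%N ->
  tree_take (degree x) (tree_comp x y) = x.
Proof.
move=> + dy; elim: x => [|l _ [|b c] IH] // _.
  by rewrite [degree _]/= addn0 [tree_comp _ _]/= tree_take_graft.
set r := Node b c in IH *; rewrite [tree_comp _ _]/= -/r /=.
rewrite (_ : (_ < _)%N = false); last lia.
by rewrite subSS addKn [tree_take _ _]IH.
Qed.

Lemma tree_drop_comp x y : (0 < degree x)%N ->
  tree_drop (degree x).-1 (tree_comp x y) = y.
Proof.
elim: x => [|l _ [|b c] IH] // _.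
  by rewrite [degree _]/= addn0 [tree_comp _ _]/= tree_drop_graft.
set r := Node b c in IH *; rewrite [tree_comp _ _]/= -/r /=.
rewrite (_ : (_ <= _)%N = false); last by rewrite /r /=; lia.
rewrite (_ : (_ - _)%N = (degree r).-1); last by rewrite /r /=; lia.
exact: IH.
Qed.

Lemma tle_graft l y y' : tle y y' -> tle (graft l y) (graft l y').
Proof.
apply: tle_homo => {}y' {}y ryy; elim/rotation_case: y' y / ryy.
- by move=> a b c; apply: tle_rot.
- by move=> a a' b _ IH /=; apply: tle_node (tle_refl _).
- by move=> a b b' rb IH /=; apply: tle_node (tle_refl _) (rotation_tle rb).
Qed.

Lemma tle_graftl l l' y : tle l l' -> tle (graft l y) (graft l' y).
Proof. by move=> ll; elim: y => //= l1 IH r1 _; apply: tle_node (tle_refl _). Qed.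

Lemma tle_graft_node a b y : tle (graft (Node a b) y) (Node a (graft b y)).
Proof.
elim: y => [|l IH r _] /=; first exact: tle_refl.
exact: tle_trans (tle_node IH (tle_refl _)) (tle_rot _ _ _).
Qed.

Lemma tle_compr x y y' : tle y y' -> tle (tree_comp x y) (tree_comp x y').
Proof.
move=> yy; elim: x => [|l _ [|b c] IH] //=; first exact: tle_graft.
exact: tle_node (tle_refl _) IH.
Qed.

(** The delicate case is a rotation of (a(bc)) with c a dot, at the last node of x: (ab) is grafted
    on y in the lower tree, only b in the upper one, and [tle_graft_node] moves a out along the left
    border of y. *)
Lemma tle_compl x x' y : tle x x' -> tle (tree_comp x y) (tree_comp x' y).
Proof.
apply: (@tle_homo (tree_comp^~ y)) => {}x' {}x rxx.
elim/rotation_case: x' x / rxx.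
- by move=> a b [|c d] /=; [apply: tle_graft_node | apply: tle_rot].
- move=> l l' [|b c] rl _ /=; first exact: tle_graftl (rotation_tle rl).
  exact: tle_node (rotation_tle rl) (tle_refl _).
- by move=> l [|b c] [|b' c'] //= _ IH; apply: tle_node (tle_refl _) IH.
Qed.

Lemma tle_node_comp x y r :
  tle (Node (tree_comp x y) r) (tree_comp x (Node y r)).
Proof.
elim: x => [|l _ [|b c] IH]; rewrite ?[tree_comp _ _]/=; try exact: tle_refl.
exact: tle_trans (tle_rot _ _ _) (tle_node (tle_refl _) IH).
Qed.

(** Induction on z, following the node number k - 1 that both cuts share. If it lies in l,
    [tle_node_comp] carries the root past the right border of the first cut; if it is the root,
    equality holds; if it lies in r, the induction hypothesis for r applies. *)
Lemma tle_comp_cut k z : (0 < k)%N -> (k <= degree z)%N ->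
  tle z (tree_comp (tree_take k z) (tree_drop k.-1 z)).
Proof.
elim: z k => [|l IHl r IHr] k k0 /=; first lia.
move=> kz; have [kl|kl] := leqP k (degree l).
  rewrite (_ : (k.-1 <= _)%N = true); last lia.
  exact: tle_trans (tle_node (IHl _ k0 kl) (tle_refl _)) (tle_node_comp _ _ _).
have [kl'|kl'] := leqP k.-1 (degree l).
  have -> : k = (degree l).+1 by lia.
  by rewrite /= subnn tree_take0 /= tree_drop_all //; apply: tle_refl.
set j := (k - (degree l).+1)%N.
have -> : (k.-1 - (degree l).+1 = j.-1)%N by rewrite /j; lia.
have := IHr j; case ej : (tree_take j r) => [|b c]; last first.
  by move=> IH; apply: tle_node (tle_refl l) (IH _ _); rewrite /j; lia.
by have := degree_tree_take j r; rewrite ej /= /j; lia.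
Qed.

(** An adjunction: the cuts are monotone and recover x and y from their graft, while grafting is
    monotone and z lies below the graft of its own cuts. *)
Lemma tle_compP x y z : (0 < degree x)%N -> (0 < degree y)%N ->
  degree z = (degree x + degree y).-1 ->
  tle z (tree_comp x y) <->
  tle (tree_take (degree x) z) x /\ tle (tree_drop (degree x).-1 z) y.
Proof.
move=> dx dy dz; split=> [zxy|[zx zy]].
  split; first by have := tle_take (degree x) zxy; rewrite tree_take_comp.
  by have := tle_drop (degree x).-1 zxy; rewrite tree_drop_comp.
apply: tle_trans (tle_comp_cut dx _) _; first lia.
exact: tle_trans (tle_compl _ zx) (tle_compr _ zy).
Qed.

(* The trees whose first [degree s] inner nodes form s and whose remaining ones
   form [Node Dot r]. *)
Fixpoint join_trees (s r : bintree) : seq bintree :=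
  Node s r ::
  (if s is Node s1 s2 then map (Node s1) (join_trees s2 r) else [::]).

(** A tree lies above [Node l r] iff its first [degree l] nodes form a tree above l and the others a
    tree [Node Dot r'] with r' above r. Sums of operations over this enumeration can be computed by
    induction. *)
Fixpoint up_list (x : bintree) : seq bintree :=
  if x is Node l r then
    [seq z | p <- [seq (s, r') | s <- up_list l, r' <- up_list r],
             z <- join_trees p.1 p.2]
  else [:: Dot].

Lemma join_trees_tle s r z : z \in join_trees s r -> tle (Node s r) z.
Proof.
elim: s z => [|s1 _ s2 IH] z; rewrite inE; first by move/eqP->; apply: tle_refl.
case/predU1P=> [->|/mapP[z' /IH zz' ->]]; first exact: tle_refl.
exact: tle_trans (tle_rot _ _ _) (tle_node (tle_refl _) zz').
Qed.

Lemma join_treesP s r z : z \in join_trees s r ->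
  tree_take (degree s) z = s /\ tree_drop (degree s) z = Node Dot r.
Proof.
elim: s z => [|s1 _ s2 IH] z; rewrite inE.
  by move/eqP->.
case/predU1P=> [->|/mapP[z' /IH[t' d'] ->]].
  by rewrite tree_take_root tree_drop_root.
rewrite /= (_ : (_ < _)%N = false); last lia.
by rewrite subSS addKn t' d'.
Qed.

Lemma mem_join_trees k z r : tree_drop k z = Node Dot r ->
  z \in join_trees (tree_take k z) r.
Proof.
elim: z k => [|l IHl r1 IHr] //= k; case: ifP => [kl [dl <-]|kl dk].
  rewrite tree_take_all; last by have := degree_tree_drop k l; rewrite dl /=; lia.
  by case: (l) => *; rewrite /= inE eqxx.
by rewrite inE map_f ?orbT //; apply: IHr.
Qed.

Lemma mem_up_list x z : z \in up_list x <-> tle x z.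
Proof.
elim: x z => [|l IHl r IHr] z.
  rewrite inE; split=> [/eqP ->|/tle_degree/esym/degree0 -> //]; exact: tle_refl.
split=> [/allpairsPdep[[s r']][z' []] | xz].
  case/allpairsP=> [[s1 r1] [/= /IHl ls /IHr rr [-> ->]]].
  by move=> /join_trees_tle zz ->; apply: tle_trans (tle_node ls rr) zz.
have := tle_take (degree l) xz; rewrite tree_take_root => /IHl ls.
have := tle_drop (degree l) xz; rewrite tree_drop_root.
case/tle_Dotl=> r' dz /IHr rr.
apply/allpairsPdep; exists (tree_take (degree l) z, r'), z; split=> //.
  by apply/allpairsP; exists (tree_take (degree l) z, r').
exact: mem_join_trees.
Qed.

Lemma join_trees_uniq s r : uniq (join_trees s r).
Proof.
elim: s => //= s1 _ s2 IH; rewrite map_inj_uniq ?IH ?andbT; last by move=> ? ? [].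
apply/mapP=> -[z' _ [e _]]; have := congr1 degree e; rewrite /=; lia.
Qed.

(** Cutting after [degree l] nodes recovers the pair (s, r'), so distinct pairs contribute disjoint
    lists. *)
Lemma up_list_uniq x : uniq (up_list x).
Proof.
elim: x => // l IHl r IHr; apply: allpairs_uniq_dep => [|p _|].
- by apply: allpairs_uniq => // -[? ?] [? ?].
- exact: join_trees_uniq.
move=> u v /allpairsPdep[_ [z [/allpairsP[[s r1] [/= ls _ ->]] zj ->]]].
case/allpairsPdep=> [_ [z' [/allpairsP[[s' r2] [/= ls' _ ->]] zj' ->]]] /= e.
rewrite -{}e in zj' *.
have dd : degree s = degree s'.
  by move/mem_up_list/tle_degree: ls; move/mem_up_list/tle_degree: ls' => <-.
have [] := join_treesP zj; have [] := join_treesP zj'; rewrite /= -dd.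
by move=> -> -> <- [<-].
Qed.

Local Open Scope ring_scope.

(** * Upper sums as operations *)

Section AdditiveMaps.

Variables (V W : zmodType) (f : V -> W).
Hypothesis fD : forall x y, f (x + y) = f x + f y.

Lemma additive_map0 : f 0 = 0.
Proof. by apply: (addrI (f 0)); rewrite -fD !addr0. Qed.

Lemma additive_map_sum (I : Type) (s : seq I) (P : pred I) (F : I -> V) :
  f (\sum_(i <- s | P i) F i) = \sum_(i <- s | P i) f (F i).
Proof. exact: (big_morph f fD additive_map0). Qed.

Lemma additive_mapN x : f (- x) = - f x.
Proof. by apply: (addrI (f x)); rewrite -fD !subrr additive_map0. Qed.

Lemma additive_mapMz x (k : int) : f (x *~ k) = f x *~ k.
Proof.
have fMn n : f (x *+ n) = f x *+ n.
  by elim: n => [|n IH]; rewrite ?additive_map0 // !mulrS fD IH.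
by case: k => n; rewrite ?NegzE ?mulrNz ?additive_mapN fMn.
Qed.

End AdditiveMaps.

Section DendriformOperations.

Variable D : dendAlgebra.
Implicit Types (a b : nat -> D) (s l r x y z : bintree) (c g : D).

Local Notation "c ≺ g" := (@dprec D c g) (at level 40).
Local Notation "c ≻ g" := (@dsucc D c g) (at level 40).

Definition dstar c g : D := c ≺ g + c ≻ g.

Lemma dstarA c g u : dstar (dstar c g) u = dstar c (dstar g u).
Proof.
by rewrite /dstar dprecDl dprec_prec dsucc_prec dsuccDr dsucc_succ addrA.
Qed.

Lemma dstarDl : left_distributive dstar +%R.
Proof. by move=> c g u; rewrite /dstar dprecDl dsuccDl addrACA. Qed.

Lemma dstarDr : right_distributive dstar +%R.
Proof. by move=> c g u; rewrite /dstar dprecDr dsuccDr addrACA. Qed.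

(** A dot stands for an absent factor; these variants omit it, so that one formula covers the four
    shapes of a node. *)
Definition lstar l u c := if l is Node _ _ then dstar u c else c.
Definition lsucc l u c := if l is Node _ _ then u ≻ c else c.
Definition rprec r c u := if r is Node _ _ then c ≺ u else c.

Lemma tree_opE l r a :
  tree_op (Node l r) a =
  rprec r (lsucc l (tree_op l a) (a (degree l)))
    (tree_op r (fun j => a ((degree l).+1 + j)%N)).
Proof. by case: l r => [|? ?] [|? ?]. Qed.

Lemma tree_op_ext x a b :
  (forall j, (j < degree x)%N -> a j = b j) -> tree_op x a = tree_op x b.
Proof.
elim: x a b => // l IHl r IHr a b ab; rewrite !tree_opE.
congr rprec; first congr lsucc.
- by apply: IHl => j jl; apply: ab => /=; lia.
- by apply: ab => /=; lia.
- by apply: IHr => j jr; apply: ab => /=; lia.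
Qed.

(** Let c be the right factor. The head of the list gives s \succ c. The tail gives, by induction, g
    \prec (s2 * c), which the first dendriform axiom turns into s \prec c. *)
Lemma join_trees_op s r a :
  \sum_(z <- join_trees s r) tree_op z a =
  lstar s (tree_op s a)
    (rprec r (a (degree s)) (tree_op r (fun j => a ((degree s).+1 + j)%N))).
Proof.
elim: s a => [|s1 _ s2 IH] a; first by rewrite big_seq1 tree_opE.
rewrite [join_trees _ _]/= big_cons big_map tree_opE.
set s := Node s1 s2; set c := rprec r (a (degree s)) _.
have -> : forall u v, rprec r (lsucc s u (a (degree s))) v =
  lsucc s u (rprec r (a (degree s)) v).
  by move=> u v; case: (r) => //= ? ?; rewrite dsucc_prec.
rewrite -/c /lsucc /lstar /s -/s /dstar addrC; congr (_ + _).
set g := lsucc s1 (tree_op s1 a) (a (degree s1)).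
pose sh := fun j => a ((degree s1).+1 + j)%N.
transitivity (g ≺ (\sum_(z <- join_trees s2 r) tree_op z sh)).
  rewrite (additive_map_sum (dprecDr g)) !big_seq; apply: eq_bigr => z.
  by case: z => [/join_trees_tle/tle_degree //|z1 z2] _; rewrite tree_opE.
rewrite IH [tree_op s a]tree_opE -/g -/sh.
have -> : rprec r (sh (degree s2))
   (tree_op r (fun j => sh ((degree s2).+1 + j)%N)) = c.
  rewrite /c /s /=; congr rprec.
  by apply: tree_op_ext => j _; rewrite /sh; congr (a _); lia.
by case: (s2) => //= ? ?; rewrite dprec_prec.
Qed.

(* With * = dprec + dsucc, the operation of the upper sum of [Node l r] is
   U_l * (a_k dprec U_r). *)
Fixpoint up_op x a : D :=
  if x is Node l r then
    lstar l (up_op l a)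
      (rprec r (a (degree l)) (up_op r (fun j => a ((degree l).+1 + j)%N)))
  else 0.

Lemma up_list_op x a : (0 < degree x)%N ->
  \sum_(z <- up_list x) tree_op z a = up_op x a.
Proof.
elim: x a => // l IHl r IHr a _.
rewrite [up_list _]/= big_allpairs_dep big_allpairs /=.
set k := degree l; set sh := fun j => a (k.+1 + j)%N.
transitivity (\sum_(s <- up_list l) \sum_(r' <- up_list r)
    lstar l (tree_op s a) (rprec r (a k) (tree_op r' sh))).
  rewrite !big_seq; apply: eq_bigr => s /mem_up_list/tle_degree ds.
  rewrite !big_seq; apply: eq_bigr => r' /mem_up_list/tle_degree dr.
  rewrite join_trees_op -ds -/k -/sh.
  by case: (l) (s) ds => [|? ?] [|? ?] //; case: (r) (r') dr => [|? ?] [|? ?].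
transitivity (\sum_(s <- up_list l) lstar l (tree_op s a)
    (rprec r (a k) (up_op r sh))).
  apply: eq_bigr => s _; case: (r) IHr => [|r1 r2] IHr; first by rewrite big_seq1.
  rewrite /= -/(up_op (Node r1 r2) sh) -IHr //.
  rewrite (additive_map_sum (dprecDr _)); case: (l) => [|? ?] //=.
  by rewrite (additive_map_sum (dstarDr _)).
case: (l) IHl => [|l1 l2] IHl; first by rewrite big_seq1.
rewrite /= -/(up_op (Node l1 l2) a) -IHl //.
by rewrite -(additive_map_sum (f := fun u => dstar u _)
  (fun u v : D => dstarDl u v _)).
Qed.

Lemma up_op_ext x a b :
  (forall j, (j < degree x)%N -> a j = b j) -> up_op x a = up_op x b.
Proof.
elim: x a b => // l IHl r IHr a b ab /=; congr lstar; last congr rprec.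
- by apply: IHl => j jl; apply: ab => /=; lia.
- by apply: ab => /=; lia.
- by apply: IHr => j jr; apply: ab => /=; lia.
Qed.

(** The left border of y spells a product for the associative operation [dstar]; a tree grafted at
    its end is one more factor on the left. *)
Lemma up_op_graft l y a : (0 < degree y)%N ->
  up_op (graft l y) a =
  lstar l (up_op l a) (up_op y (fun j => a (degree l + j)%N)).
Proof.
elim: y => // l' IH r' _ _ /=.
rewrite degree_graft; set c := rprec r' _ _; set c' := rprec r' _ _.
have -> : c' = c.
  by congr rprec; apply: up_op_ext => j _; congr (a _); lia.
case: l' IH @c @c' => [|l1 l2] IH c c' //.
rewrite [LHS](_ : _ = dstar (up_op (graft l (Node l1 l2)) a) c) // IH // /lstar.
by case: (l) => //= l3 l4; rewrite dstarA.
Qed.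

(** The last input of U_x sits at the end of the right border of x. Descending to it reduces the
    claim to x = [Node l Dot], which is [up_op_graft]. *)
Lemma up_op_comp x y a b : (0 < degree x)%N -> (0 < degree y)%N ->
  (forall j, (j < (degree x).-1)%N -> b j = a j) ->
  b (degree x).-1 = up_op y (fun j => a ((degree x).-1 + j)%N) ->
  up_op x b = up_op (tree_comp x y) a.
Proof.
move=> + dy; elim: x a b => // l _ r IHr a b _ ab bx.
have lE c : lstar l (up_op l b) c = lstar l (up_op l a) c.
  by congr lstar; apply: up_op_ext => j jl; apply: ab => /=; lia.
rewrite [up_op _ b]/= lE.
case: r IHr ab bx => [|r1 r2] IHr ab bx.
  by move: bx; rewrite /= addn0 => ->; rewrite up_op_graft.
set r := Node r1 r2 in IHr ab bx *.
rewrite (_ : tree_comp (Node l r) y = Node l (tree_comp r y)) //.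
have dt : (0 < degree (tree_comp r y))%N by rewrite degree_tree_comp //=; lia.
move: (tree_comp r y) dt IHr => t dt IHr; rewrite [RHS]/=; congr lstar.
rewrite (ab (degree l)); last by rewrite /r /=; lia.
rewrite (IHr (fun j => a ((degree l).+1 + j)%N)) //.
- by case: (t) dt.
- by move=> j jr; apply: ab; rewrite /=; move: jr; rewrite /=; lia.
have e : ((degree l).+1 + (degree r).-1 = (degree (Node l r)).-1)%N.
  by rewrite /r /=; lia.
rewrite e bx; apply: up_op_ext => j _; congr (a _); move: e; lia.
Qed.

Lemma up_opD x a b b' : (0 < degree x)%N ->
  (forall j, (j < (degree x).-1)%N -> a j = b j /\ a j = b' j) ->
  a (degree x).-1 = b (degree x).-1 + b' (degree x).-1 ->
  up_op x a = up_op x b + up_op x b'.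
Proof.
elim: x a b b' => // l _ r IHr a b b' _ ab ax.
have lE c : lstar l (up_op l b) c = lstar l (up_op l a) c.
  by congr lstar; apply: up_op_ext => j jl; have [] := ab j; rewrite //=; lia.
have lE' c : lstar l (up_op l b') c = lstar l (up_op l a) c.
  by congr lstar; apply: up_op_ext => j jl; have [] := ab j; rewrite //=; lia.
rewrite /= lE lE'.
have lD c c' u : lstar l u (c + c') = lstar l u c + lstar l u c'.
  by case: (l) => //= ? ?; apply: dstarDr.
rewrite -lD; congr lstar.
case: r IHr ab ax => [|r1 r2] IHr ab ax.
  by move: ax; rewrite /= addn0.
set r := Node r1 r2 in IHr ab ax *.
rewrite {1 3 5}/r /rprec.
have [<- <-] : a (degree l) = b (degree l) /\ a (degree l) = b' (degree l).
  by apply: ab; rewrite /r /=; lia.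
rewrite -dprecDr; congr dprec; apply: IHr => //.
  by move=> j jr; apply: ab; rewrite /=; move: jr; rewrite /=; lia.
have e : ((degree l).+1 + (degree r).-1 = (degree (Node l r)).-1)%N.
  by rewrite /r /=; lia.
by rewrite e.
Qed.

End DendriformOperations.

(** * A dendriform algebra separating the trees *)

(* Functions of intervals [i, j) with i, j < N: an interval is cut at k, and the
   two operations record on which side the maximum of h lies. *)
Section IntervalAlgebra.

Variables (N : nat) (h : nat -> nat).

Definition max_on (i j : nat) : nat := \max_(i <= k < j) h k.

Lemma max_on_cat i k j : (i <= k)%N -> (k <= j)%N ->
  max_on i j = maxn (max_on i k) (max_on k j).
Proof. by move=> ik kj; rewrite /max_on (big_cat_nat ik kj). Qed.

Definition cut (P : rel nat) (i k j : nat) : int :=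
  [&& (i < k)%N, (k < j)%N & P (max_on i k) (max_on k j)]%:R.

Lemma max_on_ge i j k : (i <= k < j)%N -> (h k <= max_on i j)%N.
Proof.
by move=> ikj; apply: leq_bigmax_seq => //; rewrite mem_index_iota.
Qed.

Lemma max_on_lt i j d : (0 < d)%N ->
  (forall k, (i <= k < j)%N -> (h k < d)%N) -> (max_on i j < d)%N.
Proof.
case: d => // d _ hd; rewrite ltnS; apply/bigmax_leqP_seq => k.
by rewrite mem_index_iota => /hd.
Qed.

Definition cut_prod (w : nat -> nat -> nat -> int) (f g : nat -> nat -> int) :=
  fun i j => \sum_(k < N) w i k j * (f i k * g k j).

Lemma cut_prodDl w : left_distributive (cut_prod w) +%R.
Proof.
move=> f f' g; apply/funext=> i; apply/funext=> j; rewrite !fctE -big_split /=.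
by apply: eq_bigr => k _; rewrite !fctE mulrDl mulrDr.
Qed.

Lemma cut_prodDr w : right_distributive (cut_prod w) +%R.
Proof.
move=> f g g'; apply/funext=> i; apply/funext=> j; rewrite !fctE -big_split /=.
by apply: eq_bigr => k _; rewrite !fctE !mulrDr.
Qed.

(** Both sides sum over two cuts l < k of [i, j). The maximum over a union is the larger of the
    maxima, so the weights only involve the maxima p, q, r of the three pieces. *)
Lemma cut_prodA (P1 P2 P3 P4 : rel nat) f g u :
  (forall p q r, P1 (maxn p q) r && P2 p q = P3 p (maxn q r) && P4 q r) ->
  cut_prod (cut P1) (cut_prod (cut P2) f g) u =
  cut_prod (cut P3) f (cut_prod (cut P4) g u).
Proof.
move=> PP; apply/funext=> i; apply/funext=> j; rewrite /cut_prod.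
under eq_bigr do rewrite mulr_suml mulr_sumr.
rewrite exchange_big /=; apply: eq_bigr => l _; rewrite !mulr_sumr.
apply: eq_bigr => k _.
have ww : cut P1 i k j * cut P2 i l k = cut P3 i l j * cut P4 l k j.
  rewrite /cut -!natrM; congr _%:R.
  have [il|il] := ltnP i l; last by rewrite andFb muln0.
  have [lk|lk] := ltnP l k; last by rewrite andbF muln0 muln0.
  have [kj|kj] := ltnP k j; last by rewrite !andbF muln0.
  rewrite (ltn_trans il lk) (ltn_trans lk kj) /=.
  rewrite (max_on_cat (ltnW il) (ltnW lk)) (max_on_cat (ltnW lk) (ltnW kj)).
  by rewrite !mulnb PP.
transitivity ((cut P1 i k j * cut P2 i l k) * (f i l * (g l k * u k j))).
  by ring.
by rewrite ww; ring.
Qed.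

(** Ties go to the left, so that exactly one of the two conditions holds at each cut and the two
    products add up to the unrestricted one. *)
Definition ge_side : rel nat := fun p q => (q <= p)%N.
Definition lt_side : rel nat := fun p q => (p < q)%N.

Lemma cut_prod_both f g :
  cut_prod (cut ge_side) f g + cut_prod (cut lt_side) f g =
  cut_prod (cut (fun _ _ => true)) f g.
Proof.
apply/funext=> i; apply/funext=> j; rewrite !fctE -big_split /=.
apply: eq_bigr => k _; rewrite -mulrDl /cut /ge_side /lt_side -natrD.
rewrite [(max_on i k < _)%N]ltnNge.
by case: (_ < _)%N; case: (_ < _)%N; case: (_ <= _)%N.
Qed.

Lemma interval_prec_prec f g u :
  cut_prod (cut ge_side) (cut_prod (cut ge_side) f g) u =
  cut_prod (cut ge_side) f
    (cut_prod (cut ge_side) g u + cut_prod (cut lt_side) g u).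
Proof.
by rewrite cut_prod_both; apply: cut_prodA => p q r; rewrite /ge_side; lia.
Qed.

Lemma interval_succ_prec f g u :
  cut_prod (cut ge_side) (cut_prod (cut lt_side) f g) u =
  cut_prod (cut lt_side) f (cut_prod (cut ge_side) g u).
Proof. by apply: cut_prodA => p q r; rewrite /ge_side /lt_side; lia. Qed.

Lemma interval_succ_succ f g u :
  cut_prod (cut lt_side)
    (cut_prod (cut ge_side) f g + cut_prod (cut lt_side) f g) u =
  cut_prod (cut lt_side) f (cut_prod (cut lt_side) g u).
Proof.
by rewrite cut_prod_both; apply: cut_prodA => p q r; rewrite /lt_side; lia.
Qed.

Definition intervalDend : dendAlgebra :=
  @DendAlgebra (nat -> nat -> int)
    (cut_prod (cut ge_side)) (cut_prod (cut lt_side))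
    (cut_prodDl (cut ge_side)) (cut_prodDr (cut ge_side))
    (cut_prodDl (cut lt_side)) (cut_prodDr (cut lt_side))
    interval_prec_prec interval_succ_prec interval_succ_succ.

Definition unit_interval : intervalDend := fun i j => (j == i.+1)%:R.

Lemma cut_prodE P f g i k j : (k < N)%N ->
  (forall l, (i < l < j)%N -> l != k -> f i l * g l j = 0) ->
  cut_prod (cut P) f g i j = cut P i k j * (f i k * g k j).
Proof.
move=> kN fg; rewrite /cut_prod (bigD1 (Ordinal kN)) //= big1 ?addr0 // => l lk.
rewrite /cut; case: (boolP (i < l < j)%N) => [ilj|/negbTE nilj].
  by rewrite fg ?mulr0.
by rewrite andbA nilj mul0r.
Qed.

Lemma cut_prod_eq0 P f g i j :
  (forall k, (k < N)%N -> (i < k < j)%N -> f i k * g k j = 0) ->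
  cut_prod (cut P) f g i j = 0.
Proof.
move=> fg; apply: big1 => k _; rewrite /cut andbA.
by case: (boolP (i < k < j)%N) => [ikj|_] /=; rewrite ?mul0r // fg ?mulr0 //.
Qed.

(** Each input is supported on intervals of length one and products concatenate intervals, so
    lengths add up to the degree. *)
Lemma tree_op_eq0 t i j : (j != i + degree t)%N -> (i < N)%N -> (j < N)%N ->
  tree_op t (fun=> unit_interval) i j = 0.
Proof.
elim: t i j => // l IHl r IHr i j ij iN jN; rewrite tree_opE.
set u : intervalDend := lsucc _ _ _.
have u0 k : (k != (i + degree l).+1)%N -> (k < N)%N -> u i k = 0.
  rewrite /u; case: l {u} IHl ij => [|l1 l2] IHl ij ki kN.
    by rewrite /= /unit_interval; case: eqP => // e; move: ki; rewrite /= e addn0 eqxx.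
  apply: cut_prod_eq0 => p pN ipk.
  case: (eqVneq p (i + degree (Node l1 l2))%N) => [e|ne]; last by rewrite IHl ?mul0r.
  by rewrite /unit_interval e (negbTE ki) mulr0.
case: r IHr ij => [|r1 r2] IHr ij.
  by apply: u0 => //; move: ij; rewrite /= addn0 addnS.
apply: cut_prod_eq0 => p pN ipk.
case: (eqVneq p (i + degree l).+1) => [e|ne]; last by rewrite u0 ?mul0r.
rewrite IHr ?mulr0 // e; apply: contraNneq ij => ->; rewrite /=; lia.
Qed.

(** At the dot this is the indicator of empty intervals, where [tree_op] is 0: absent factors then
    count as 1 in [tree_coef_node]. *)
Definition tree_coef (t : bintree) (i j : nat) : int :=
  if t is Dot then (j == i)%:R else tree_op t (fun=> unit_interval) i j.

Lemma tree_coef_eq0 t i j : (j != i + degree t)%N -> (i < N)%N -> (j < N)%N ->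
  tree_coef t i j = 0.
Proof.
case: t => [|l r] ij iN jN; last exact: tree_op_eq0.
by move: ij; rewrite /= addn0 => /negbTE ->.
Qed.

(** Only the cuts on either side of the root position k contribute; the two conditions come from
    [lt_side] and [ge_side]. Positivity of [h k] makes the first one true when the left part is
    empty, with maximum 0. *)
Lemma tree_coef_node l r i j k : (j < N)%N -> k = (i + degree l)%N ->
  (k < j)%N -> (0 < h k)%N ->
  tree_coef (Node l r) i j =
  ((max_on i k < h k) && (max_on k.+1 j <= max_on i k.+1))%N%:R *
  (tree_coef l i k * tree_coef r k.+1 j).
Proof.
move=> jN ek kj hk.
have iN : (i < N)%N by lia.
have kE : max_on k k.+1 = h k by rewrite /max_on big_nat1.
rewrite [LHS](_ : _ = tree_op (Node l r) (fun=> unit_interval) i j) // tree_opE;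
 set u : intervalDend := lsucc _ _ _.
have u0 p : (p != k.+1)%N -> (p < N)%N -> u i p = 0.
  move=> pk pN; have := @tree_op_eq0 (Node l Dot) i p; rewrite tree_opE; apply => //.
  by rewrite /= addn0 addnS -ek.
have uE : u i k.+1 = (max_on i k < h k)%N%:R * tree_coef l i k.
  rewrite /u; case: l {u u0} ek => [|l1 l2] ek.
    rewrite /= /unit_interval (_ : i = k) ?eqxx /max_on ?big_geq ?hk //.
    by rewrite ek addn0.
  have e := @cut_prodE lt_side (tree_op (Node l1 l2) (fun=> unit_interval))
    unit_interval i k k.+1.
  apply: etrans (e _ _) _; [lia | move=> p ipk pk | ].
    by rewrite tree_op_eq0 ?mul0r -?ek //; lia.
  rewrite /unit_interval eqxx mulr1 /cut ltnSn kE (_ : (i < k)%N) //.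
  by rewrite ek /=; lia.
rewrite -mulnb natrM mulrACA -uE mulrC.
case: r => [|r1 r2].
  rewrite /=; case: (eqVneq j k.+1) => [->|ne]; last by rewrite u0 ?mulr0 ?mul0r.
  by rewrite /max_on [X in (X <= _)%N]big_geq // mulr1 mul1r.
have e := @cut_prodE ge_side u (tree_op (Node r1 r2) (fun=> unit_interval)) i k.+1 j.
apply: etrans (e _ _) _; [lia | by move=> p ipj pk; rewrite u0 ?mul0r //; lia | ].
rewrite /cut /ge_side; case: (ltngtP k.+1 j) kj => // kj _.
  by rewrite ltnS ek leq_addr /= [u _ _ * _]mulrC mulrA.
(* The right part is empty although r is not a dot: both sides vanish. *)
rewrite kj andbF mul0r /max_on big_geq // mul1r.
by rewrite tree_coef_eq0 ?mul0r //=; lia.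
Qed.

End IntervalAlgebra.

(* Heights decrease away from the root, so that cutting intervals at their
   highest position rebuilds the tree. *)
Fixpoint height (t : bintree) (p : nat) : nat :=
  if t is Node l r then
    if (p < degree l)%N then height l p
    else if p == degree l then degree t else height r (p - (degree l).+1)
  else 0.

Lemma height_bounds t p : (p < degree t)%N -> (0 < height t p <= degree t)%N.
Proof.
elim: t p => // l IHl r IHr p /= pt.
case: (ltnP p (degree l)) => [pl|lp]; first by have := IHl p pl; lia.
case: (eqVneq p (degree l)) => npl; first lia.
by have := IHr (p - (degree l).+1)%N; lia.
Qed.

(** The heights have their strict maximum at the root of t. If the root of s lies to its left, the
    second condition of [tree_coef_node] fails; if to its right, the first. If the roots agree, both
    hold and the coefficient factors over the subtrees. *)
Lemma tree_coef_height N h s t i : degree s = degree t -> (i + degree t < N)%N ->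
  (forall p, (p < degree t)%N -> h (i + p)%N = height t p) ->
  tree_coef N h s i (i + degree t) = (s == t)%:R.
Proof.
elim: s t i => [|l IHl r IHr] [|l' r'] i // st itN hE; first by rewrite /= addn0 eqxx.
have h_pos p : (i <= p < i + degree (Node l' r'))%N -> (0 < h p)%N.
  move=> ip; rewrite (_ : p = i + (p - i))%N ?hE; try lia.
  by have := @height_bounds (Node l' r') (p - i); lia.
have h_root : h (i + degree l')%N = degree (Node l' r').
  by rewrite hE /= ?ltnn ?eqxx //; lia.
have h_lt p : (i <= p < i + degree (Node l' r'))%N -> p != (i + degree l')%N ->
    (h p < degree (Node l' r'))%N.
  move=> ip pl; rewrite (_ : p = i + (p - i))%N ?hE; try lia.
  rewrite [height _ _]/=; case: (ltnP (p - i) (degree l')) => pl'.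
    by have := @height_bounds l' (p - i); rewrite /=; lia.
  case: (eqVneq (p - i)%N (degree l')) => pl''; first lia.
  by have := @height_bounds r' (p - i - (degree l').+1); rewrite /= in ip *; lia.
rewrite (@tree_coef_node _ _ _ _ _ _ (i + degree l)%N) //; try (move: st => /=; lia); last first.
  by apply: h_pos; move: st => /=; lia.
set k := (i + degree l)%N.
case: (ltngtP (degree l) (degree l')) => ll.
- suff lt_max : (max_on h i k.+1 < max_on h k.+1 (i + degree (Node l' r')))%N.
    rewrite [X in _ && X]leqNgt lt_max andbF mul0r.
    by case: eqP => // -[e _]; move: ll; rewrite e ltnn.
  apply: (@leq_trans (degree (Node l' r'))); last first.
    have := @max_on_ge h k.+1 (i + degree (Node l' r')) (i + degree l').
    by rewrite h_root; apply; rewrite /k /=; lia.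
  by apply: max_on_lt => // p; rewrite /k => ip; apply: h_lt => /=; lia.
- suff le_max : (h k <= max_on h i k)%N.
    rewrite ltnNge le_max mul0r.
    by case: eqP => // -[e _]; move: ll; rewrite e ltnn.
  apply: (@leq_trans (degree (Node l' r'))); last first.
    have := @max_on_ge h i k (i + degree l').
    by rewrite h_root; apply; rewrite /k /=; lia.
  by apply: ltnW; apply: h_lt; move: st; rewrite /k /=; lia.
have rr : degree r = degree r' by move: st => /=; lia.
have hk : h k = degree (Node l' r') by rewrite /k ll.
rewrite (_ : _ && _ = true); last first.
  apply/andP; split.
    rewrite hk; apply: max_on_lt => // p; rewrite /k => ip.
    by apply: h_lt => /=; lia.
  apply: (@leq_trans (h k)); last by apply: max_on_ge; rewrite /k; lia.
  apply: ltnW; rewrite hk; apply: max_on_lt => // p; rewrite /k => ip.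
  by apply: h_lt; move: ip => /=; lia.
have -> : (i + degree (Node l' r') = k.+1 + degree r')%N by rewrite /k /=; lia.
have kN : (k.+1 + degree r' < N)%N by move: itN; rewrite /k /=; lia.
rewrite /k ll IHl // ?IHr //; last first.
- move=> p pl; rewrite hE /= ?pl //; lia.
- move: kN; rewrite /k; lia.
- move=> p pr; rewrite -ll -/k (_ : (k.+1 + p = i + (degree l' + p.+1))%N) ?hE /=; try lia.
  rewrite ifF; last by lia.
  rewrite ifF; last by lia.
  by congr height; lia.
- by rewrite -ll.
rewrite mul1r -natrM mulnb; congr _%:R.
by congr nat_of_bool; apply/andP/eqP => [[/eqP -> /eqP ->]|[-> ->]].
Qed.

(** In the interval algebra with the heights of t, evaluation on unit intervals, read at [0, n),
    returns the coefficient of t. The bound [n.+1] admits the end point n. *)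
Lemma dend_op_inj n (w w' : Dend n) : (0 < n)%N ->
  (forall (D : dendAlgebra) (a : nat -> D), dend_op w a = dend_op w' a) -> w = w'.
Proof.
move=> n0 ww; apply/ffunP => t.
have dt : degree t = n := degreeY t.
set D := intervalDend n.+1 (height t).
suff E (v : Dend n) : dend_op (D := D) v (fun=> unit_interval _ _) 0%N n = v t.
  by rewrite -E ww E.
have evD (f g : D) : (f + g) 0%N n = f 0%N n + g 0%N n by [].
rewrite /dend_op (additive_map_sum (f := fun f : D => f 0%N n) evD).
have treeE (s : Y n) :
    (tree_op s (fun=> unit_interval _ _) : D) 0%N n = (s == t)%:R.
  have ds : degree s = n := degreeY s.
  have := @tree_coef_height n.+1 (height t) s t 0; rewrite ds dt add0n.
  rewrite -val_eqE /= => <- //.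
  by move: ds; rewrite /tree_coef; case: (ytree s) => //= e; rewrite -e in n0.
rewrite (bigD1 t) //= big1 => [|s /negbTE st].
  by rewrite (additive_mapMz (f := fun f : D => f 0%N n) evD) treeE eqxx addr0 intz.
by rewrite (additive_mapMz (f := fun f : D => f 0%N n) evD) treeE st mul0rz.
Qed.

(** * The product # *)

Section RelSum.

Variables (T : finType) (r : rel T).
Hypotheses (r_refl : reflexive r) (r_anti : antisymmetric r)
  (r_trans : transitive r).

(** For the Tamari order and its converse, these are the upper and the lower sums. *)
Definition rel_sum (x : T) : {ffun T -> int} := \sum_(y | r x y) basis_elt y.

Lemma sum_ffunMzE (I : Type) (s : seq I) (P : pred I) (F : I -> {ffun T -> int})
    (a : I -> int) y :
  (\sum_(i <- s | P i) F i *~ a i) y = \sum_(i <- s | P i) F i y * a i.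
Proof.
have evD (f g : {ffun T -> int}) : (f + g) y = f y + g y by rewrite ffunE.
rewrite (additive_map_sum (f := fun f : {ffun T -> int} => f y) evD).
apply: eq_bigr => i _.
by rewrite (additive_mapMz (f := fun f : {ffun T -> int} => f y) evD) mulrzz.
Qed.

Lemma basis_sum (v : {ffun T -> int}) : v = \sum_y basis_elt y *~ v y.
Proof.
apply/ffunP=> y; rewrite sum_ffunMzE (bigD1 y) //= big1 => [|z zy].
  by rewrite ffunE eqxx mul1r addr0.
by rewrite ffunE eq_sym (negbTE zy) mul0r.
Qed.

Lemma rel_sumE x y : rel_sum x y = (r x y)%:R.
Proof.
have evD (f g : {ffun T -> int}) : (f + g) y = f y + g y by rewrite ffunE.
rewrite /rel_sum (additive_map_sum (f := fun f : {ffun T -> int} => f y) evD).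
case: (boolP (r x y)) => rxy; last first.
  rewrite big1 // => z rxz; rewrite ffunE; case: eqP => // e.
  by rewrite -e (negbTE rxy) in rxz.
rewrite (bigD1 y) //= ffunE eqxx big1 // => z /andP[_ zy].
by rewrite ffunE eq_sym (negbTE zy).
Qed.

(** Triangularity: at y the equation only involves the coefficients of those x with [r x y], and
    induction on their number isolates that of y. *)
Lemma rel_sum_free (a b : T -> int) :
  \sum_x rel_sum x *~ a x = \sum_x rel_sum x *~ b x -> a =1 b.
Proof.
move=> ab y; have [k] := ubnPleq #|[pred x | r x y]|.
elim: k y => [|k IH] y ky.
  by move: ky; rewrite leqn0 => /eqP/card0_eq/(_ y); rewrite inE r_refl.
have /ffunP/(_ y) := ab; rewrite !sum_ffunMzE (bigD1 y) // [RHS](bigD1 y) //=.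
rewrite rel_sumE r_refl !mul1r; set A := \sum_(i | _) _; set B := \sum_(i | _) _.
suff -> : A = B by apply: addIr.
apply: eq_bigr => x xy; rewrite rel_sumE; case: (boolP (r x y)) => rxy; last by rewrite !mul0r.
rewrite IH // -ltnS; apply: leq_trans ky; apply/proper_card/properP; split.
  by apply/fintype.subsetP => z; rewrite !inE => /r_trans; apply.
exists y; rewrite !inE // ?r_refl //; apply: contra xy => ryx.
by apply/eqP/r_anti; rewrite rxy.
Qed.

(** Inversion by induction: [basis_elt y] is [rel_sum y] minus the basis elements at the other x
    with [r y x], each of which has fewer elements beyond it. *)
Lemma rel_sum_span (v : {ffun T -> int}) :
  exists a : T -> int, v = \sum_x rel_sum x *~ a x.
Proof.
pose spanned u := exists a : T -> int, u = \sum_x rel_sum x *~ a x.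
have span0 : spanned 0 by exists (fun=> 0); rewrite big1 // => x _; rewrite mulr0z.
have spanD u u' : spanned u -> spanned u' -> spanned (u + u').
  move=> [a ->] [b ->]; exists (fun x => a x + b x); rewrite -big_split /=.
  by apply: eq_bigr => x _; rewrite mulrzDr.
have spanM u k : spanned u -> spanned (u *~ k).
  move=> [a ->]; exists (fun x => a x * k).
  rewrite (additive_map_sum (f := fun u : {ffun T -> int} => u *~ k)
    (fun x y => mulrzDl k x y)).
  by apply: eq_bigr => x _; rewrite mulrzA.
have span_basis y : spanned (basis_elt y).
  have [k] := ubnPleq #|[pred x | r y x]|.
  elim: k y => [|k IH] y ky.
    by move: ky; rewrite leqn0 => /eqP/card0_eq/(_ y); rewrite inE r_refl.
  have -> : basis_elt y =
      rel_sum y + (\sum_(x | r y x && (x != y)) basis_elt x) *~ (-1).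
    by rewrite /rel_sum (bigD1 y) //= mulrN1z addrK.
  apply: (spanD).
    exists (fun x => (x == y)%:R); rewrite (bigD1 y) //= eqxx big1 ?addr0 //.
    by move=> x /negbTE ->; rewrite mulr0z.
  apply: (spanM); apply: (big_ind spanned) => // x /andP[ryx xy]; apply: IH.
  rewrite -ltnS; apply: leq_trans ky; apply/proper_card/properP; split.
    by apply/fintype.subsetP => z; rewrite !inE; apply: r_trans.
  exists y; rewrite !inE // ?r_refl //; apply: contra xy => rxy.
  by apply/eqP/r_anti; rewrite rxy.
rewrite (basis_sum v); apply: (big_ind spanned) => // y _; exact: spanM.
Qed.

End RelSum.

(** * Theta on upper and lower sums *)

Section Theta.

Variable n : nat.
Implicit Types (x y : Y n) (v w : Dend n) (a b : Y n -> int).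

Lemma down_sumE x y : down_sum x y = (y <= x)%O%:R.
Proof. exact: (rel_sumE (fun u v : Y n => (v <= u)%O)). Qed.

Lemma up_sum_free a b :
  \sum_x up_sum x *~ a x = \sum_x up_sum x *~ b x -> a =1 b.
Proof. exact: (rel_sum_free (@lexx _ (Y n)) le_anti le_trans). Qed.

Lemma up_sum_span v : exists a, v = \sum_x up_sum x *~ a x.
Proof. exact: (rel_sum_span (@lexx _ (Y n)) le_anti le_trans). Qed.

Lemma down_sum_free a b :
  \sum_x down_sum x *~ a x = \sum_x down_sum x *~ b x -> a =1 b.
Proof.
exact: (@rel_sum_free _ (fun u v : Y n => (v <= u)%O) (@lexx _ _) ge_anti
  ge_trans).
Qed.

Lemma down_sum_span v : exists a, v = \sum_x down_sum x *~ a x.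
Proof.
exact: (@rel_sum_span _ (fun u v : Y n => (v <= u)%O) (@lexx _ _) ge_anti
  ge_trans).
Qed.

Lemma theta_up_sum a :
  theta (\sum_x up_sum x *~ a x) = - \sum_x down_sum x *~ a x.
Proof.
apply: xget_unique; first by exists a.
by move=> w [b [/up_sum_free ab ->]]; under eq_bigr do rewrite -ab.
Qed.

Lemma theta_inv_down_sum a :
  theta_inv (\sum_x down_sum x *~ a x) = \sum_x up_sum x *~ - a x.
Proof.
apply: xget_unique => /= [|w tw].
  rewrite theta_up_sum -sumrN; apply: eq_bigr => x _.
  by rewrite mulrNz opprK.
have [b wE] := up_sum_span w; rewrite wE in tw *.
apply: eq_bigr => x _; congr (_ *~ _); apply: oppr_inj; rewrite opprK.
apply: (@down_sum_free (fun x => - b x)); rewrite -tw theta_up_sum -sumrN.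
by apply: eq_bigr => {}x _; rewrite mulrNz.
Qed.

Lemma dend_opD (D : dendAlgebra) (f : nat -> D) v w :
  dend_op (v + w) f = dend_op v f + dend_op w f.
Proof. by rewrite -big_split; apply: eq_bigr => t _; rewrite ffunE mulrzDr. Qed.

Lemma dend_op_sum (D : dendAlgebra) (f : nat -> D) (I : Type) (s : seq I)
    (F : I -> Dend n) (c : I -> int) :
  dend_op (\sum_(i <- s) F i *~ c i) f = \sum_(i <- s) dend_op (F i) f *~ c i.
Proof.
have fD := dend_opD f; rewrite (additive_map_sum fD).
by apply: eq_bigr => i _; rewrite (additive_mapMz fD).
Qed.

Lemma dend_op_up_sum (D : dendAlgebra) (f : nat -> D) x : (0 < n)%N ->
  dend_op (up_sum x) f = up_op x f.
Proof.
move=> n0; rewrite -up_list_op ?degreeY // /dend_op.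
transitivity (\sum_(t : Y n | (x <= t)%O) tree_op t f).
  rewrite [RHS]big_mkcond /=; apply: eq_bigr => t _.
  rewrite (rel_sumE (fun u v : Y n => (u <= v)%O)).
  by case: ifP; rewrite ?mulr0z ?mulr1z.
rewrite -big_filter -(big_map val predT (fun t => tree_op t f)) /=.
apply: perm_big; apply: uniq_perm; rewrite ?up_list_uniq //.
  by rewrite map_inj_uniq ?filter_uniq ?index_enum_uniq //; apply: val_inj.
move=> z; apply/mapP/idP => [[t]|/mem_up_list xz].
  by rewrite mem_filter => /andP[/tamari_leP xt _ ->]; apply/mem_up_list.
have dz : degree z == n by rewrite -(tle_degree xz) degreeY.
exists (MkY dz) => //; rewrite mem_filter mem_index_enum andbT.
exact/tamari_leP.
Qed.

End Theta.

Section Sharp.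

Variables m n : nat.
Hypotheses (m_gt0 : (0 < m)%N) (n_gt0 : (0 < n)%N).

Lemma Ycomp_subproof (x : Y m) (y : Y n) :
  degree (tree_comp x y) == (m + n).-1.
Proof. by rewrite degree_tree_comp !degreeY. Qed.

Definition Ycomp (x : Y m) (y : Y n) : Y (m + n).-1 := MkY (Ycomp_subproof x y).

Lemma Ytake_subproof (z : Y (m + n).-1) : degree (tree_take m z) == m.
Proof. by rewrite degree_tree_take degreeY; apply/eqP; lia. Qed.

Definition Ytake (z : Y (m + n).-1) : Y m := MkY (Ytake_subproof z).

Lemma Ydrop_subproof (z : Y (m + n).-1) : degree (tree_drop m.-1 z) == n.
Proof. by rewrite degree_tree_drop degreeY; apply/eqP; lia. Qed.

Definition Ydrop (z : Y (m + n).-1) : Y n := MkY (Ydrop_subproof z).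

Lemma Ytake_homo : {homo Ytake : z z' / (z <= z')%O}.
Proof. by move=> z z' /tamari_leP zz; apply/tamari_leP/tle_take. Qed.

Lemma Ydrop_homo : {homo Ydrop : z z' / (z <= z')%O}.
Proof. by move=> z z' /tamari_leP zz; apply/tamari_leP/tle_drop. Qed.

Lemma le_Ycomp x y z : (z <= Ycomp x y)%O = (Ytake z <= x)%O && (Ydrop z <= y)%O.
Proof.
have := @tle_compP x y z; rewrite !degreeY => /(_ m_gt0 n_gt0 erefl) cP.
apply/tamari_leP/andP => [/cP[zx zy]|[/tamari_leP zx /tamari_leP zy]].
  by split; apply/tamari_leP.
exact/cP.
Qed.

(** [up_op_comp] settles a pair of upper sums, additivity in the last input extends it to
    combinations, and [dend_op_inj] gives the uniqueness that [xget] requires. *)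
Lemma dend_comp_up_sum (b : Y m -> int) (c : Y n -> int) :
  dend_comp m (\sum_x up_sum x *~ b x) (\sum_y up_sum y *~ c y) =
  \sum_(p : Y m * Y n) up_sum (Ycomp p.1 p.2) *~ (b p.1 * c p.2).
Proof.
have mn0 : (0 < (m + n).-1)%N by lia.
set v := \sum_x _; set w := \sum_y _; set u := \sum_p _.
have uP (D : dendAlgebra) (a : nat -> D) :
    dend_op u a =
    dend_op v (insert_args m n (dend_op w (fun j => a (m.-1 + j)%N)) a).
  rewrite !dend_op_sum -(pair_bigA _ (fun x y =>
    dend_op (up_sum (Ycomp x y)) a *~ (b x * c y))) /=.
  apply: eq_bigr => x _; rewrite dend_op_up_sum //.
  pose f (g : D) := up_op x (insert_args m n g a).
  have fD g g' : f (g + g') = f g + f g'.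
    (* Positions are numbered from 1 and inputs from 0: g occupies input m - 1 and no other. *)
    apply: up_opD; rewrite degreeY //.
      by move=> j jm; rewrite /insert_args (_ : (j.+1 < m)%N) //; lia.
    by rewrite /insert_args prednK // ltnn eqxx.
  rewrite -/(f _) (additive_map_sum fD).
  rewrite (additive_map_sum (f := fun g : D => g *~ b x)
    (fun g g' => mulrzDl (b x) g g')).
  apply: eq_bigr => y _; rewrite (additive_mapMz fD) !dend_op_up_sum //.
  rewrite mulrC mulrzA; congr (_ *~ _ *~ _); symmetry.
  apply: up_op_comp; rewrite ?degreeY //.
    by move=> j jm; rewrite /insert_args (_ : (j.+1 < m)%N) //; lia.
  by rewrite /insert_args prednK // ltnn eqxx.
apply: xget_unique => [|w' w'P] /=; first exact: uP.
by apply: dend_op_inj => // D a; rewrite w'P uP.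
Qed.

Lemma sharpE (v : Dend m) (w : Dend n) z :
  sharp v w z = v (Ytake z) * w (Ydrop z).
Proof.
have [b ->] := down_sum_span v; have [c ->] := down_sum_span w.
rewrite /sharp !theta_inv_down_sum dend_comp_up_sum.
(* [theta_up_sum] expects a family indexed by trees, so e t collects the pairs whose graft is t. *)
have [e eE] : exists e : Y (m + n).-1 -> int,
    e = fun t => \sum_(p : Y m * Y n | Ycomp p.1 p.2 == t) b p.1 * c p.2.
  by eexists.
have -> : \sum_(p : Y m * Y n) up_sum (Ycomp p.1 p.2) *~ (- b p.1 * - c p.2) =
          \sum_t up_sum t *~ e t.
  rewrite (partition_big (fun p => Ycomp p.1 p.2) xpredT) //=.
  apply: eq_bigr => t _; rewrite eE.
  rewrite (big_morph (fun k => up_sum t *~ k) (mulrzDr (up_sum t)) (mulr0z _)).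
  by apply: eq_bigr => p /eqP ->; rewrite mulrNN.
rewrite theta_up_sum opprK !sum_ffunMzE eE.
rewrite mulr_suml; under [RHS]eq_bigr do rewrite mulr_sumr.
rewrite pair_bigA /= [RHS](partition_big (fun p => Ycomp p.1 p.2) xpredT) //=.
apply: eq_bigr => t _; rewrite mulr_sumr; apply: eq_bigr => p /eqP <-.
rewrite !down_sumE le_Ycomp -mulnb natrM; ring.
Qed.

Lemma occurs_sharpE x y z :
  occurs_sharp x y z = (Ytake z <= x)%O && (Ydrop z <= y)%O.
Proof. by rewrite /occurs_sharp sharpE !down_sumE -natrM mulnb; case: andP. Qed.

Lemma sharp_linE (w : {ffun Y m * Y n -> int}) z :
  sharp_lin w z = w (Ytake z, Ydrop z).
Proof.
rewrite /sharp_lin sum_ffunMzE (bigD1 (Ytake z, Ydrop z)) //= big1 ?addr0.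
  by rewrite sharpE !ffunE !eqxx !mul1r.
move=> [x y] xy; rewrite sharpE !ffunE -natrM mulnb /= -pair_eqE /pair_eq /= in xy *.
by rewrite (eq_sym (Ytake z)) (eq_sym (Ydrop z)) (negbTE xy) mul0r.
Qed.

End Sharp.

(** * Quiver representations and class maps *)

Definition pid_hom (b b' : nat) : 'Hom('rV[rat]_b, 'rV[rat]_b') :=
  linfun (mulmxr (pid_mx 1 : 'M_(b, b'))).

Lemma pid_homE b b' w : pid_hom b b' w = w *m pid_mx 1.
Proof. by rewrite lfunE. Qed.

Lemma pid_mx_bool (b : bool) : pid_mx 1 = 1%:M :> 'M[rat]_b.
Proof. by case: b; [rewrite pid_mx_1 | rewrite [LHS]flatmx0 [RHS]flatmx0]. Qed.

Lemma pid_hom1 (b : bool) : pid_hom b b = \1%VF.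
Proof. by apply/lfunP=> w; rewrite pid_homE pid_mx_bool mulmx1 id_lfunE. Qed.

(** Only a passage from dimension 1 through 0 back to 1 would break this, and [b -> b'] excludes
    it. *)
Lemma pid_hom_comp (b b' b'' : bool) : (b -> b') ->
  (pid_hom b' b'' \o pid_hom b b')%VF = pid_hom b b''.
Proof.
case: b => [/(_ isT) ->|_]; apply/lfunP => w; rewrite comp_lfunE !pid_homE.
  by rewrite -mulmxA (pid_mx_bool true) mul1mx.
by rewrite (thinmx0 w) !mul0mx.
Qed.

Lemma pid_mx_retract (d : nat) (b : bool) (w : 'rV[rat]_b) : (b -> 0 < d)%N ->
  w *m (pid_mx 1 : 'M_(b, d)) *m pid_mx 1 = w.
Proof.
case: b w => [w /(_ isT)|w _]; last by rewrite (thinmx0 w) !mul0mx.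
case: d => // d _; rewrite -mulmxA mul_pid_mx minnn minnSS minn0.
by rewrite (pid_mx_bool true) mulmx1.
Qed.

(** * Class maps over an acyclic quiver *)

Section Acyclic.

Variables (Q : quiver) (ht : Q -> nat).
Hypothesis arrow_ht : forall x y : Q, arrow x y -> (ht y < ht x)%N.

Lemma qpath_ht (x y : Q) : qpath x y -> (ht y <= ht x)%N.
Proof. by elim=> // {}x {}y z /arrow_ht yx _ /leq_trans -> //; apply: ltnW. Qed.

Section Simple.

Variable T : Q.

Definition simple_rep : qrep Q :=
  @QRep Q (fun x => 'rV[rat]_(x == T)) (fun x y _ => 0).

(** Heights tell empty paths from the others, which act by zero; so the map depends on the end
    points only. *)
Lemma simple_path (x y : Q) (p : qpath x y) :
  path_map simple_rep p =
  if (ht y < ht x)%N then 0 else pid_hom (x == T) (y == T).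
Proof.
case: p => [{}x|{}x z {}y a p]; first by rewrite ltnn pid_hom1.
by rewrite (leq_ltn_trans (qpath_ht p) (arrow_ht a)) /= comp_lfun0r.
Qed.

Lemma simple_comm : commuting simple_rep.
Proof. by move=> x y p q; rewrite !simple_path. Qed.

Definition simple_mod : qmodule Q := QModule simple_comm.

Lemma simple_modP : is_simple_at T simple_mod.
Proof. by move=> x; rewrite dimvf /dim /= mul1n. Qed.

End Simple.

Section Kernel.

Variables (N S : qmodule Q) (g : qhom N S).

Definition ker_obj (x : Q) : vectType rat := subvs_of (lker (g x)).

Definition ker_incl (x : Q) : 'Hom(ker_obj x, N x) := linfun vsval.

Definition ker_rep : qrep Q :=
  @QRep Q ker_obj (fun x y a =>
    (linfun (vsproj (lker (g y))) \o (rmap N a \o ker_incl x))%VF).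

Lemma ker_incl_inj x : injective (ker_incl x).
Proof. by move=> u v; rewrite !lfunE => /val_inj. Qed.

Lemma ker_incl_nat (x y : Q) (a : arrow x y) :
  (rmap N a \o ker_incl x = ker_incl y \o rmap ker_rep a)%VF.
Proof.
apply/lfunP => u; rewrite !comp_lfunE /= !lfunE /= vsprojK // memv_ker.
have /lfunP/(_ (vsval u)) := hmap_nat g a; rewrite !comp_lfunE /= => <-.
by have := subvsP u; rewrite memv_ker => /eqP ->; rewrite linear0.
Qed.

Lemma ker_path (x y : Q) (p : qpath x y) :
  (path_map N p \o ker_incl x = ker_incl y \o path_map ker_rep p)%VF.
Proof.
elim: p => [{}x|{}x {}y z a p IH]; first by rewrite comp_lfun1l comp_lfun1r.
rewrite [path_map N _]/= -comp_lfunA ker_incl_nat comp_lfunA IH.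
by rewrite -comp_lfunA.
Qed.

Lemma ker_comm : commuting ker_rep.
Proof.
move=> x y p q; apply/lfunP => u; apply: (@ker_incl_inj y).
by rewrite -!comp_lfunE -!ker_path (@qmodule_comm _ N _ _ p q).
Qed.

Definition ker_mod : qmodule Q := QModule ker_comm.

Definition ker_hom : qhom ker_mod N := @QHom Q ker_mod N ker_incl ker_incl_nat.

Lemma ker_short_exact : (forall x, limg (g x) = fullv) ->
  short_exact ker_hom g.
Proof.
move=> gs x; split=> //.
  by apply/eqP/lker0P/ker_incl_inj.
apply/vspaceP => v; apply/memv_imgP/idP => [[u _ ->]|vg].
  by rewrite lfunE; apply: subvsP.
by exists (vsproj (lker (g x)) v); rewrite ?memvf // lfunE /= vsprojK.
Qed.

End Kernel.

Definition dim_class (N : qmodule Q) : {ffun Q -> int} :=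
  [ffun x => (\dim {:N x})%:Z].

(* A source T of the support of N carries a simple quotient. *)
Lemma simple_quotient (N : qmodule Q) (x0 : Q) : \dim {:N x0} != 0 ->
  exists T : Q, exists2 g : qhom N (simple_mod T),
    \dim {:N T} != 0 & forall x, limg (g x) = fullv.
Proof.
move=> Nx0; pose T := [arg max_(x > x0 | \dim {:N x} != 0) ht x].
have [NT Tmax] : \dim {:N T} != 0 /\
    forall x, \dim {:N x} != 0 -> (ht x <= ht T)%N.
  by rewrite /T; case: arg_maxnP.
(* At T, the first coordinate in the basis given by [v2r]; elsewhere the target is zero. *)
pose g (x : Q) : 'Hom(N x, simple_mod T x) :=
  (pid_hom _ _ \o linfun v2r)%VF.
have gE x v : g x v = v2r v *m pid_mx 1 by rewrite comp_lfunE pid_homE lfunE.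
have gN x y (a : arrow x y) :
    (rmap (simple_mod T) a \o g x = g y \o rmap N a)%VF.
  rewrite /= comp_lfun0l; apply/lfunP => v; rewrite zero_lfunE comp_lfunE.
  (* An arrow into T starts at a higher vertex, where N vanishes by the choice of T; for y other
     than T the target vanishes. *)
  case: (pselect (y = T)) => [yT|/eqP yT].
    have Nx : \dim {:N x} == 0.
      by apply: contraTT (arrow_ht a) => /Tmax; rewrite yT -leqNgt.
    have -> : v = 0.
      by apply/eqP; rewrite -memv0; move: Nx; rewrite dimv_eq0 => /eqP <-; apply: memvf.
    by rewrite !linear0.
  have w0 (b : nat) (w : 'rV[rat]_b) : b = 0%N -> w = 0 by move=> b0; subst; apply: thinmx0.
  by symmetry; apply: w0; rewrite (negbTE yT).
exists T, (@QHom Q N (simple_mod T) g gN) => // x.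
apply/vspaceP => w; rewrite memvf; apply/memv_imgP.
exists (r2v (w *m pid_mx 1)); first exact: memvf.
rewrite [hmap _ _ _]gE r2vK; symmetry; apply: pid_mx_retract => /eqP ->.
by move: NT; rewrite dimvf lt0n.
Qed.

(** Induction on the total dimension: splitting off a simple quotient changes both sides by the same
    basis element. *)
Lemma class_mapE (cl : qmodule Q -> {ffun Q -> int}) : is_class_map cl ->
  forall N, cl N = dim_class N.
Proof.
move=> [cl_exact cl_simple] N.
have [k Nk] := ubnPleq (\sum_x \dim {:N x})%N.
have [dim_exact dim_simple] := dim_is_class_map Q.
elim: k N Nk => [|k IH] N Nk.
  have N0 x : \dim {:N x} = 0%N.
    by apply/eqP; move: Nk; rewrite leqn0 sum_nat_eq0 => /forall_inP; apply.
  have V0 x (U V : {vspace N x}) : U = V.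
    have U0 W : W = 0%VS :> {vspace N x}.
      by apply/eqP; rewrite -dimv_eq0 -leqn0 -(N0 x) dimvS ?subvf.
    by rewrite (U0 U) (U0 V).
  (* For N = 0 the sequence N, N, N with identity maps is exact, so the class equals its double. *)
  have e : short_exact (qhom_id N) (qhom_id N) by move=> x; split; apply: V0.
  have idem0 (u : {ffun Q -> int}) : u = u + u -> u = 0.
    by move=> uu; apply: (addrI u); rewrite -uu addr0.
  by rewrite (idem0 _ (cl_exact _ _ _ _ _ e)) -(idem0 _ (dim_exact _ _ _ _ _ e)).
case: (pselect (exists x0, \dim {:N x0} != 0)) => [[x0]|Nz]; last first.
  apply: IH; rewrite big1 // => x _; apply/eqP/negPn/negP => Nx; apply: Nz.
  by exists x.
case/simple_quotient => T [g NT gs].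
have e := ker_short_exact gs.
have dE := dim_exact _ _ _ _ _ e.
rewrite -/(dim_class _) -/(dim_class N) (dim_simple _ _ (simple_modP T)) in dE.
rewrite (cl_exact _ _ _ _ _ e) (cl_simple _ _ (simple_modP T)) [RHS]dE IH //.
rewrite -ltnS; apply: leq_trans Nk; rewrite (bigD1 T) //= [X in (_ < X)%N](bigD1 T) //=.
have dx x : \dim {:N x} = (\dim {:ker_mod g x} + (x == T))%N.
  have /ffunP/(_ x) := dE; rewrite !ffunE => /eqP.
  by rewrite natz -PoszD => /eqP[].
rewrite (dx T) eqxx addn1 addSn ltnS leq_add2l.
by apply: leq_sum => x _; rewrite dx leq_addr.
Qed.

End Acyclic.

(** * Paths and the maps they induce *)

Section Paths.

Variable Q : quiver.

Fixpoint path_cat (x y z : Q) (p : qpath x y) : qpath y z -> qpath x z :=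
  match p in qpath x y return qpath y z -> qpath x z with
  | PathNil _ => id
  | PathCons x u y a p => fun q => PathCons a (path_cat p q)
  end.

Lemma path_map_cat (V : qrep Q) (x y z : Q) (p : qpath x y) (q : qpath y z) :
  path_map V (path_cat p q) = (path_map V q \o path_map V p)%VF.
Proof.
elim: p q => [u|u v w a p IH] q /=; first by rewrite comp_lfun1r.
by rewrite IH comp_lfunA.
Qed.

Lemma qhom_path (N N' : qmodule Q) (phi : qhom N N') (x y : Q) (p : qpath x y) :
  (path_map N' p \o phi x = phi y \o path_map N p)%VF.
Proof.
elim: p => [u|u v w a p IH] /=; first by rewrite comp_lfun1l comp_lfun1r.
by rewrite -comp_lfunA hmap_nat comp_lfunA IH -comp_lfunA.
Qed.

(* Zero if there is no path from x to y. *)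
Definition conn (N : qmodule Q) (x y : Q) : 'Hom(N x, N y) :=
  xget 0 [set f | exists p : qpath x y, f = path_map N p].

Lemma connE (N : qmodule Q) (x y : Q) (p : qpath x y) :
  conn N x y = path_map N p.
Proof.
apply: xget_unique => [|_ [q ->]]; first by exists p.
exact: qmodule_comm.
Qed.

Lemma conn_comp (N : qmodule Q) (x y z : Q) :
  inhabited (qpath x y) -> inhabited (qpath y z) ->
  (conn N y z \o conn N x y)%VF = conn N x z.
Proof.
move=> [p] [q].
by rewrite (connE N p) (connE N q) (connE N (path_cat p q)) path_map_cat.
Qed.

Lemma qhom_conn (N N' : qmodule Q) (phi : qhom N N') (x y : Q) :
  inhabited (qpath x y) ->
  (conn N' x y \o phi x = phi y \o conn N x y)%VF.
Proof. by move=> [p]; rewrite !(connE _ p) qhom_path. Qed.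

Lemma qhomP (N N' : qmodule Q) (f g : qhom N N') :
  (forall x, f x = g x) -> f = g.
Proof.
case: f g => [f fN] [g gN] /= fg.
have e : f = g by apply: functional_extensionality_dep.
by subst; congr QHom; apply: Prop_irrelevance.
Qed.

End Paths.

Section HassePaths.

Variables (d : Order.disp_t) (P : finPOrderType d).

(** Induction on the size of [y, x): unless x covers y, some z strictly between splits the path into
    two. *)
Lemma hasse_path (x y : hasse P) : (y <= x :> P)%O -> inhabited (qpath x y).
Proof.
have [k] := ubnPleq #|[pred z : P | (y <= z < x)%O]|.
elim: k x y => [|k IH] x y yk yx.
  have [->|nxy] := eqVneq x y; first by constructor; apply: PathNil.
  move: yk; rewrite leqn0 => /eqP/card0_eq/(_ y).
  by rewrite inE lexx lt_neqAle eq_sym nxy yx.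
have [->|nxy] := eqVneq x y; first by constructor; apply: PathNil.
have yltx : (y < x :> P)%O by rewrite lt_neqAle eq_sym nxy yx.
have [yx_arrow|] := boolP (@arrow (hasse P) x y).
  by constructor; apply: PathCons yx_arrow (PathNil _).
rewrite /= yltx /= => /forallPn[z /negPn/andP[yz zx]].
have [p] : inhabited (@qpath (hasse P) x z).
  apply: IH (ltW zx); rewrite -ltnS; apply: leq_trans yk.
  apply/proper_card/properP; split.
    apply/fintype.subsetP => u; rewrite !inE => /andP[zu ->].
    by rewrite (le_trans (ltW yz) zu).
  by exists y; rewrite !inE ?lexx ?yltx // lt_geF.
have [q] : inhabited (@qpath (hasse P) z y).
  apply: IH (ltW yz); rewrite -ltnS; apply: leq_trans yk.
  apply/proper_card/properP; split.
    apply/fintype.subsetP => u; rewrite !inE => /andP[-> uz].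
    by rewrite (lt_trans uz zx).
  by exists z; rewrite !inE ?ltxx ?andbF // (ltW yz) zx.
by constructor; apply: path_cat p q.
Qed.

Definition down_card (x : hasse P) : nat := #|[pred z : P | (z < x)%O]|.

Lemma hasse_arrow_card (x y : hasse P) :
  arrow x y -> (down_card y < down_card x)%N.
Proof.
case/andP => yx _; apply/proper_card/properP; split.
  by apply/fintype.subsetP => u; rewrite !inE => /lt_trans; apply.
by exists y; rewrite !inE ?ltxx.
Qed.

End HassePaths.

Lemma prodq_path (A B : quiver) (x x' : A) (y y' : B) :
  inhabited (qpath x x') -> inhabited (qpath y y') ->
  inhabited (@qpath (prodq A B) (x, y) (x', y')).
Proof.
move=> [p] [q]; constructor; apply: (@path_cat (prodq A B) _ (x', y)).
  elim: p => [u|u v w a p IH]; first exact: PathNil.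
  by apply: PathCons IH; rewrite /= a eqxx.
elim: q => [u|u v w a q IH]; first exact: PathNil.
by apply: PathCons IH; rewrite /= a eqxx orbT.
Qed.

(** * Tensor products *)

Lemma bilinear_lfun (U V W : vectType rat) (f : U -> V -> W) :
  (forall v, linear (f^~ v)) -> (forall u, linear (f u)) ->
  {t : 'Hom(U, 'Hom(V, W)) | forall u v, t u v = f u v}.
Proof.
move=> fl fr.
pose h u : {linear V -> W} :=
  HB.pack (f u) (GRing.isLinear.Build rat V W *:%R (f u) (fr u)).
have hl : linear (fun u => linfun (h u)).
  move=> a u u'; apply/lfunP => v.
  by rewrite add_lfunE scale_lfunE !lfunE /= (fl v).
pose t : {linear U -> 'Hom(V, W)} := HB.pack (fun u => linfun (h u))
  (GRing.isLinear.Build rat U 'Hom(V, W) *:%R (fun u => linfun (h u)) hl).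
by exists (linfun t) => u v; rewrite !lfunE.
Qed.

(** The comparison map from T to T' is injective: followed by the one back it is the identity, by
    uniqueness in the universal property of T. *)
Lemma is_tensor_dim_le (A B R : quiver) (N : qmodule (prodq A B))
    (M : trimodule A B R) (z : R) (T T' : vectType rat) t t' :
  @is_tensor A B R N M z T t -> @is_tensor A B R N M z T' t' ->
  (\dim {:T} <= \dim {:T'})%N.
Proof.
move=> [tb tU] [tb' tU'].
have [h [hP _]] := tU _ _ tb'; have [h' [hP' _]] := tU' _ _ tb.
have [i [_ iU]] := tU _ _ tb.
have hK : (h' \o h)%VF = \1%VF.
  transitivity i; first by symmetry; apply: iU => c v w; rewrite comp_lfunE hP hP'.
  by apply: iU => c v w; rewrite id_lfunE.
have h_inj : lker h = 0%VS.
  apply/eqP/lker0P => u v huv.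
  by rewrite -[u]id_lfunE -[v]id_lfunE -hK !comp_lfunE huv.
rewrite -(limg_ker_dim h fullv) h_inj capv0 dimv0 add0n.
exact: dimvS (subvf _).
Qed.

(** The coordinate of a vector of dimension 1, and 0 in dimension 0, without transport between row
    types. *)
Definition scal (b : nat) (w : 'rV[rat]_b) : rat := (w *m pid_mx 1 : 'rV_1) 0 0.

Lemma scal_linear b : linear (@scal b : _ -> rat^o).
Proof. by move=> a w w'; rewrite /scal mulmxDl -scalemxAl !mxE. Qed.

Lemma scalE (b : bool) (w : 'rV[rat]_b) : w = scal w *: pid_mx 1.
Proof.
case: b w => w; last by rewrite [LHS]thinmx0 [RHS]thinmx0.
rewrite /scal !(pid_mx_bool true) mulmx1; apply/rowP => j.
by rewrite !mxE !ord1 eqxx mulr1.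
Qed.

Lemma scal_pid (b b' : bool) (w : 'rV[rat]_b) : (b -> b') ->
  scal (w *m pid_mx 1 : 'rV_b') = scal w.
Proof.
case: b w => w; last by rewrite (thinmx0 w) /scal !mul0mx.
by move=> /(_ isT) ->; rewrite (pid_mx_bool true) mulmx1.
Qed.

Lemma scal0 (b : bool) (w : 'rV[rat]_b) : ~~ b -> scal w = 0.
Proof. by case: b w => // w _; rewrite (thinmx0 w) /scal mul0mx mxE. Qed.

Lemma scal1 : scal (pid_mx 1 : 'rV_1) = 1.
Proof. by rewrite /scal !(pid_mx_bool true) mulmx1 mxE. Qed.

(** * Tri-modules whose support is a principal filter for each z *)

Section FilterTensor.

Variables (dA dB dR : Order.disp_t).
Variables (PA : finPOrderType dA) (PB : finPOrderType dB) (PR : finPOrderType dR).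
Variables (f : PR -> PA) (g : PR -> PB).
Hypotheses (f_homo : {homo f : z z' / (z <= z')%O})
  (g_homo : {homo g : z z' / (z <= z')%O}).

Let A := hasse PA.
Let B := hasse PB.
Let R := hasse PR.
Let Q := prodq (prodq (opq A) (opq B)) R.

Variable supp : Q -> bool.
Hypothesis suppE : forall x y z, supp (x, y, z) = (f z <= x)%O && (g z <= y)%O.

Definition cut_pair (z : R) : prodq A B := (f z, g z).

Lemma cut_pair_qpath (z z' : R) :
  qpath z z' -> inhabited (qpath (cut_pair z) (cut_pair z')).
Proof.
move=> p; have zz : (z' <= z :> PR)%O.
  elim: p => // {}z u {}z' /andP[/ltW uz _] _.
  by move/le_trans; apply.
by apply: prodq_path; apply: hasse_path; [apply: f_homo | apply: g_homo].
Qed.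

Lemma supp_path (c : prodq A B) (z : R) : supp (c, z) -> inhabited (qpath c (cut_pair z)).
Proof.
case: c => x y; rewrite suppE => /andP[zx zy].
by apply: prodq_path; apply: hasse_path.
Qed.

Lemma supp_cut_pair (z : R) : supp (cut_pair z, z).
Proof. by rewrite suppE !lexx. Qed.

(** Arrows raise x and y and lower z, and f and g are monotone. Hence no path leaves the support,
    which yields all commuting relations. *)
Lemma supp_arrow (u v : Q) : arrow u v -> supp u -> supp v.
Proof.
case: u v => [[x y] z] [[x' y'] z']; rewrite !suppE /= => a /andP[zx zy].
case/orP: a => [/andP[a /eqP <-]|/andP[/eqP[<- <-]] /andP[/ltW zz _]].
  case/orP: a => /andP.
    by case=> /andP[/ltW xx _] /eqP <-; rewrite (le_trans zx xx).
  by case=> /eqP <- /andP[/ltW yy _]; rewrite zx (le_trans zy yy).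
by rewrite (le_trans (f_homo zz) zx) (le_trans (g_homo zz) zy).
Qed.

Lemma supp_qpath (c c' : prodq A B) (z : R) (p : qpath c c') :
  supp (c', z) -> supp (c, z).
Proof.
elim: p => // {}c c1 {}c' a p IH /IH; exact: supp_arrow (tri_arrow_op z a).
Qed.

(* With f, g the two cutting maps and supp the support of M, this is [Msharp]. *)
Definition filter_rep : qrep Q :=
  @QRep Q (fun u => 'rV[rat]_(supp u))
    (fun u v _ => linfun (mulmxr (pid_mx 1 : 'M_(supp u, supp v)))).

Lemma filter_path (u v : Q) (p : qpath u v) :
  path_map filter_rep p = pid_hom (supp u) (supp v).
Proof.
elim: p => [{}u|{}u {}v w a p IH] /=; first by rewrite pid_hom1.
by rewrite IH -[linfun _]/(pid_hom _ _) pid_hom_comp //; apply: supp_arrow.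
Qed.

Lemma filter_comm : commuting filter_rep.
Proof. by move=> u v p q; rewrite !filter_path. Qed.

Definition filter_mod : trimodule A B R := QModule filter_comm.

Lemma Mmap (u v : Q) (a : arrow u v) (w : 'rV[rat]_(supp u)) :
  rmap filter_mod a w = w *m pid_mx 1.
Proof. by rewrite [rmap _ _]/(pid_hom _ _) pid_homE. Qed.

(** The co-Yoneda map: v (x) w is sent to the image of v in [N (cut_pair z)], scaled by w. *)
Definition tensor_map (N : qmodule (prodq A B)) (z : R) (c : prodq A B) :
    'Hom(N c, 'Hom(filter_mod (c, z), N (cut_pair z))).
Proof.
apply: (proj1_sig (@bilinear_lfun (N c) (filter_mod (c, z)) (N (cut_pair z))
  (fun v w => scal w *: conn N c (cut_pair z) v) _ _)) => [w a v v'|v a w w'].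
  by rewrite linearP scalerDr !scalerA mulrC.
by rewrite scal_linear scalerDl scalerA.
Defined.

Lemma tensor_mapE (N : qmodule (prodq A B)) (z : R) (c : prodq A B) v
    (w : 'rV[rat]_(supp (c, z))) :
  tensor_map N z c v w = scal w *: conn N c (cut_pair z) v.
Proof. exact: (proj2_sig (bilinear_lfun _ _)). Qed.

(** M(-, z) is generated by the vector e at [cut_pair z], so a balanced b is determined by its
    values b(v, e), which define h. *)
Lemma tensor_mapP (N : qmodule (prodq A B)) (z : R) :
  is_tensor (M := filter_mod) (tensor_map N z).
Proof.
split=> [c c' a v w|U b bb].
  have sup : supp (c', z) -> supp (c, z).
    exact: supp_arrow (tri_arrow_op z a).
  rewrite !tensor_mapE Mmap scal_pid //.
  case: (orP (orbN (supp (c', z)))) => [/supp_path[p]|s0]; last first.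
    by rewrite scal0 // !scale0r.
  by rewrite (connE N p) (connE N (PathCons a p)) /= comp_lfunE.
pose e (c : prodq A B) : filter_mod (c, z) := (pid_mx 1 : 'rV[rat]_(supp (c, z))).
have [h hE] : exists h : 'Hom(N (cut_pair z), U),
    forall v, h v = b (cut_pair z) v (e (cut_pair z)).
  have hl : linear (fun v => b (cut_pair z) v (e (cut_pair z))).
    by move=> k v v'; rewrite linearP add_lfunE scale_lfunE.
  pose h : {linear N (cut_pair z) -> U} :=
    HB.pack (fun v => b (cut_pair z) v (e (cut_pair z)))
    (GRing.isLinear.Build rat _ U *:%R _ hl).
  by exists (linfun h) => v; rewrite lfunE.
exists h; split=> [c v w|h' h'P].
  rewrite tensor_mapE linearZ /= hE.
  case: (orP (orbN (supp (c, z)))) => [sup|s0]; last first.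
    rewrite scal0 // scale0r; have -> : w = 0; last by rewrite linear0.
    by rewrite [w]scalE scal0 // scale0r.
  rewrite [w in RHS]scalE linearZ /=; congr (_ *: _).
  have [p] := supp_path sup; rewrite (connE N p).
  (* Balancedness moves each arrow of the path from v to M, where it sends e to e inside the
     support. *)
  elim: p (supp_cut_pair z) v {sup w} => [{}c|{}c c1 c2 a p IH] s v.
    by rewrite /= id_lfunE.
  rewrite /= comp_lfunE IH // bb; congr (b _ _ _).
  rewrite Mmap /e; have := supp_qpath p s.
  by case: (supp _) => // _; rewrite (pid_mx_bool true) mul1mx.
(* Uniqueness: v is itself the image of v (x) e. *)
apply/lfunP => v; rewrite hE -h'P tensor_mapE.
rewrite (connE N (PathNil _)) /= id_lfunE /e.
by rewrite supp_cut_pair scal1 scale1r.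
Qed.

Section Functor.

Variable N : qmodule (prodq A B).

(** An arrow z -> z' need not map to an arrow of the product, only to a path; hence [conn]. *)
Definition pull_rep : qrep R :=
  @QRep R (fun z => N (cut_pair z))
    (fun z z' _ => conn N (cut_pair z) (cut_pair z')).

Lemma pull_path (z z' : R) (p : qpath z z') :
  path_map pull_rep p = conn N (cut_pair z) (cut_pair z').
Proof.
elim: p => [{}z|{}z u {}z' a p IH] /=; first by rewrite (connE N (PathNil _)).
rewrite IH conn_comp //; apply: cut_pair_qpath => //.
exact: PathCons a (PathNil _).
Qed.

Lemma pull_comm : commuting pull_rep.
Proof. by move=> z z' p q; rewrite !pull_path. Qed.

Definition pull_mod : qmodule R := QModule pull_comm.

End Functor.

Lemma pull_nat (N N' : qmodule (prodq A B)) (phi : qhom N N') (z z' : R)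
    (a : arrow z z') :
  (rmap (pull_mod N') a \o phi (cut_pair z) =
   phi (cut_pair z') \o rmap (pull_mod N) a)%VF.
Proof.
apply: qhom_conn; apply: cut_pair_qpath.
exact: PathCons a (PathNil _).
Qed.

Definition pull_hom (N N' : qmodule (prodq A B)) (phi : qhom N N') :
    qhom (pull_mod N) (pull_mod N') :=
  @QHom R (pull_mod N) (pull_mod N') (fun z => phi (cut_pair z)) (pull_nat phi).

Lemma pull_hom_id N : pull_hom (qhom_id N) = qhom_id (pull_mod N).
Proof. exact: qhomP. Qed.

Lemma pull_hom_comp (N N' N'' : qmodule (prodq A B)) (psi : qhom N' N'')
    (phi : qhom N N') :
  pull_hom (qhom_comp psi phi) = qhom_comp (pull_hom psi) (pull_hom phi).
Proof. exact: qhomP. Qed.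

Definition pull_functor : qfunctor (prodq A B) R :=
  QFunctor pull_hom_id pull_hom_comp.

Lemma pull_is_tensor : is_tensor_functor filter_mod pull_functor.
Proof.
exists tensor_map; split=> [N z|N z z' r c v w|N N' phi z c v w].
- exact: tensor_mapP.
- have sup : supp (c, z) -> supp (c, z').
    exact: supp_arrow (tri_arrow c r).
  rewrite !tensor_mapE Mmap scal_pid // linearZ /=.
  case: (orP (orbN (supp (c, z)))) => [/supp_path p|s0]; last first.
    by rewrite scal0 // !scale0r.
  congr (_ *: _); rewrite -comp_lfunE conn_comp //; apply: cut_pair_qpath.
  exact: PathCons r (PathNil _).
- rewrite !tensor_mapE linearZ /=.
  case: (orP (orbN (supp (c, z)))) => [/supp_path p|s0]; last first.
    by rewrite scal0 // !scale0r.
  by congr (_ *: _); rewrite -!comp_lfunE qhom_conn.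
Qed.

(** Comparison with the pull-back in both directions covers every functor with the universal
    property, not just the one constructed. *)
Lemma tensor_functor_dim (F : qfunctor (prodq A B) R) :
  is_tensor_functor filter_mod F ->
  forall N z, \dim {:F N z} = \dim {:N (cut_pair z)}.
Proof.
move=> [t [tP _ _]] N z; apply/eqP; rewrite eqn_leq.
rewrite (is_tensor_dim_le (tP N z) (tensor_mapP N z)).
exact: is_tensor_dim_le (tensor_mapP N z) (tP N z).
Qed.

Lemma tensor_functor_class (F : qfunctor (prodq A B) R) clQ clR N z :
  is_tensor_functor filter_mod F -> is_class_map clQ -> is_class_map clR ->
  clR (F N) z = clQ N (cut_pair z).
Proof.
move=> FM clQP clRP.
(* An arrow of the product changes one coordinate, so the sum of the two heights drops. *)
pose htQ (c : prodq A B) := (down_card c.1 + down_card c.2)%N.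
have htQP (c c' : prodq A B) : arrow c c' -> (htQ c' < htQ c)%N.
  case/orP=> /andP[a b]; rewrite /htQ.
    by rewrite (eqP b) ltn_add2r; apply: hasse_arrow_card.
  by rewrite (eqP a) ltn_add2l; apply: hasse_arrow_card.
rewrite (class_mapE htQP clQP) (class_mapE (@hasse_arrow_card _ _) clRP).
by rewrite !ffunE tensor_functor_dim.
Qed.

End FilterTensor.

Theorem mainTheorem5 (m n : nat) (m_gt0 : (0 < m)%N) (n_gt0 : (0 < n)%N) :
  exists Mcomm : commuting (Msharp m n),
    let M : trimodule (hasse (Y m)) (hasse (Y n)) (hasse (Y (m + n).-1)) :=
      QModule Mcomm in
    (exists F : qfunctor (prodq (hasse (Y m)) (hasse (Y n)))
                         (hasse (Y (m + n).-1)),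
       is_tensor_functor M F) /\
    (forall F : qfunctor (prodq (hasse (Y m)) (hasse (Y n)))
                         (hasse (Y (m + n).-1)),
       is_tensor_functor M F -> induces F (@sharp_lin m n)).
Proof.
exists (filter_comm (Ytake_homo m_gt0 n_gt0) (Ydrop_homo m_gt0 n_gt0)
  (occurs_sharpE m_gt0 n_gt0)); split=> [|F FM clQ clR clQP clRP N].
  by eexists; apply: pull_is_tensor.
apply/ffunP => z; rewrite (sharp_linE m_gt0 n_gt0).
exact: tensor_functor_class FM clQP clRP.
Qed.
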